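(* Let $\Gamma$ be a finite $X$-symmetric graph with a nontrivial $X$-invariant partition $\mathcal B$ of $V(\Gamma)$ such that $k=3$ and $val(\Gamma_{\mathcal B})\ge 2$. Let $B\in\mathcal B$. Suppose that $X$ acts faithfully on $V(\Gamma)$ and that $\Gamma$ is not a multicover of $\Gamma_{\mathcal B}$. Then $\Gamma_{\mathcal B}$ is $(X,2)$-arc-transitive if and only if one of the following holds: (a) $(v,b,r)=(4,4,3)$ and $X_B^B\cong A_4$ or $S_4$; (b) $(v,b,r)=(6,4,2)$ and $X_B^B\cong A_4$ or $S_4$; (c) $(v,b,r)=(7,7,3)$ and $X_B^B\cong PSL(3,2)$; (d) $v=3b\ge 6$, $r=1$, and $X_B$ acts $2$-transitively on the set of blocks $\Gamma_{\mathcal B}(B)$ of $\mathcal D(B)$.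
   Context: All graphs are finite, simple and undirected; $\Sigma(\tau)$ is the neighbourhood of a vertex $\tau$ and $val(\Sigma)$ the valency of a regular graph. For $s\ge 1$ an $s$-arc is a sequence $(\alpha_0,\dots,\alpha_s)$ of vertices with $\alpha_i,\alpha_{i+1}$ adjacent and $\alpha_{i-1}\neq\alpha_{i+1}$; arcs are $1$-arcs. For a group $X$ acting on $V(\Sigma)$ preserving adjacency, $\Sigma$ is $X$-symmetric if $X$ is transitive on vertices and on arcs, and $(X,2)$-arc-transitive if moreover $X$ is transitive on $2$-arcs. For a set $S$, $X_S$ and $X_{(S)}$ are the setwise and pointwise stabilisers and $X_S^S\cong X_S/X_{(S)}$ is the permutation group induced on $S$. An $X$-invariant partition $\mathcal B$ of $V(\Gamma)$ is one whose blocks are permuted by $X$; it is nontrivial if $1<|B|<|V(\Gamma)|$. The quotient graph $\Gamma_{\mathcal B}$ has vertex set $\mathcal B$, with $B,C$ adjacent iff some vertex of $B$ is adjacent to some vertex of $C$; it is assumed to have an edge. For $C\in\mathcal B$, $\Gamma(C)=\bigcup_{\mathfrak u\in C}\Gamma(\mathfrak u)$; $\Gamma_{\mathcal B}(B)$ is the neighbourhood of $B$ in $\Gamma_{\mathcal B}$; for a vertex $\mathfrak v$, $\Gamma_{\mathcal B}(\mathfrak v)=\{C\in\mathcal B:\mathfrak v\in\Gamma(C)\}$. The parameters $v=|B|$, $k=|\Gamma(C)\cap B|$ for $C\in\Gamma_{\mathcal B}(B)$, $r=|\Gamma_{\mathcal B}(\mathfrak v)|$ and $b=val(\Gamma_{\mathcal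 B})$ are independent of the choices. $\mathcal D(B)$ is the incidence structure with point set $B$, block set $\Gamma_{\mathcal B}(B)$, and $\mathfrak v$ incident with $C$ iff $C\in\Gamma_{\mathcal B}(\mathfrak v)$. $\Gamma$ is a multicover of $\Gamma_{\mathcal B}$ if $k=v$. *)

(* Defs.v *)
From HB Require Import structures.
From mathcomp Require Import all_boot all_order all_algebra.
From mathcomp Require Import all_fingroup all_solvable.

Set Implicit Arguments.
Unset Strict Implicit.
Unset Printing Implicit Defensive.

(* The vertices form a subset of an ambient finite type, so that a graph and
   its quotients (whose vertices are sets of vertices) have the same shape. *)
Record sgraph (T : finType) := SGraph {
  verts : {set T};
  adj : rel T;
  adj_verts : forall x y, adj x y -> x \in verts;
  adj_sym : symmetric adj;
  adj_irr : irreflexive adj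
}.

Section Graph.

Variables (T : finType) (S : sgraph T).

Definition nbhd (x : T) : {set T} := [set y in verts S | adj S x y].

Definition s_arcs (s : nat) : {set s.+1.-tuple T} :=
  [set t : s.+1.-tuple T |
    all [in verts S] t &&
    [forall i : 'I_s.+1, forall j : 'I_s.+1,
      ((j == i.+1 :> nat) ==> adj S (tnth t i) (tnth t j)) &&
      ((j == i.+2 :> nat) ==> (tnth t i != tnth t j))]].

Variables (gT : finGroupType) (to : {action gT &-> T}) (X : {group gT}).

Definition preserves_adj : Prop :=
  [acts X, on verts S | to] /\
  {in X, forall g, {in verts S &, {mono to^~ g : x y / adj S x y}}}.

Definition symmetric_graph : Prop :=
  [/\ preserves_adj,
      [transitive X, on verts S | to]
    & [transitive X, on s_arcs 1 | to * 2]].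

Definition two_arc_transitive : Prop :=
  symmetric_graph /\ [transitive X, on s_arcs 2 | to * 3].

Definition invariant_partition (P : {set {set T}}) : bool :=
  partition P (verts S) && [acts X, on P | to^*].

Definition nontrivial_partition (P : {set {set T}}) : Prop :=
  {in P, forall B : {set T}, 1 < #|B| < #|verts S|}.

(* X_A^A, realised inside the permutations of T that fix T \ A pointwise. *)
Definition induced_perm_group (A : {set T}) : {set {perm T}} :=
  (restr_perm A @* (actperm to @* 'N_X(A | to)))%g.

End Graph.

Section Quotient.

Variables (T : finType) (S : sgraph T) (P : {set {set T}}).

Definition quot_adj : rel {set T} := fun B C =>
  [&& B \in P, C \in P, B != C & [exists x in B, exists y in C, adj S x y]].

Fact quot_adj_verts B C : quot_adj B C -> B \in P.
Proof. by case/and4P. Qed.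

Fact quot_adj_sym : symmetric quot_adj.
Proof.
suff imp B C : quot_adj B C -> quot_adj C B by move=> B C; apply/idP/idP; apply: imp.
case/and4P=> PB PC neBC /exists_inP[x Bx /exists_inP[y Cy xy]].
apply/and4P; split=> //; first by rewrite eq_sym.
by apply/exists_inP; exists y => //; apply/exists_inP; exists x; rewrite // adj_sym.
Qed.

Fact quot_adj_irr : irreflexive quot_adj.
Proof. by move=> B; rewrite /quot_adj eqxx /= !andbF. Qed.

Definition quotient_graph : sgraph {set T} :=
  SGraph quot_adj_verts quot_adj_sym quot_adj_irr.

Definition set_nbhd (C : {set T}) : {set T} := \bigcup_(x in C) nbhd S x.

Definition block_nbhd (x : T) : {set {set T}} := [set C in P | x \in set_nbhd C].

(* The parameters v, k, r, b, at the block B, at the block C adjacent to B, and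
   at the vertex x of B. *)
Definition param_v (B : {set T}) : nat := #|B|.
Definition param_k (B C : {set T}) : nat := #|set_nbhd C :&: B|.
Definition param_r (x : T) : nat := #|block_nbhd x|.
Definition param_b (B : {set T}) : nat := #|nbhd quotient_graph B|.

Definition multicover (B C : {set T}) : Prop := param_k B C = param_v B.

End Quotient.

Section SpecialLinear.

Variables (n : nat) (F : finFieldType).

Definition SL : {set {'GL_n[F]}} := [set A | (\det (GLval A) == 1)%R].

Fact SL_group_set : group_set SL.
Proof.
apply/group_setP; split=> [|A B]; rewrite !inE ?GL_1E ?det1 // => /eqP dA /eqP dB.
by rewrite GL_ME det_mulmx dA dB GRing.mulr1.
Qed.
Canonical SL_group := Group SL_group_set.

Definition PSL : {set coset_of 'Z(SL)%g} := (SL / 'Z(SL))%g.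

End SpecialLinear.

(* Main.v *)
Require Import Defs.
From mathcomp Require Import all_boot all_order all_algebra.
From mathcomp Require Import all_fingroup all_solvable.
From mathcomp Require Import zify.

(** The quotient graph is [(X,2)]-arc-transitive iff [G = X_B] is 2-transitive
    on the blocks of the flag-transitive design [D(B)].  Two blocks then meet in
    a constant number [l < 3] of points, and [l (b - 1) = 3 (r - 1)] together
    with [v r = 3 b] leaves only the four parameter triples (besides (8,16,6),
    where six blocks through a point that are disjoint elsewhere need 13 points).

    For [b = 4] the actions of [G] on points and on blocks have the same kernel,
    and a subgroup of [S_4] is 2-transitive iff 12 divides its order, iff it is
    [A_4] or [S_4].  For [(7,7,3)] the design is a Fano plane: recording which
    of three nonconcurrent lines miss a point gives coordinates in [F_2^3], and
    two such coordinate systems differ by an element of [GL_3(2)], so [G] acts on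
    [B] as a subgroup of [GL_3(2)].  If it is all of [GL_3(2)] it moves any
    triangle of lines to any other.  Conversely, if [G] is 2-transitive on lines
    it contains an involution, which is an elation; its conjugates give three
    elations fixing two given lines, whence [G] has order at least
    [7 * 6 * 4 = 168]. *)

Set Implicit Arguments.
Unset Strict Implicit.
Unset Printing Implicit Defensive.

(** * Two-transitive groups, alternating groups and permutation representations *)

Section PermutationGroups.

Local Open Scope group_scope.

(** [H] acts on the whole type [W], so no set of points has to be carried along; with fewer than two
    points the condition is vacuous. *)
Definition two_transitive (W : finType) (H : {set {perm W}}) : Prop :=
  forall C D C' D', C != D -> C' != D' ->
  exists2 h, h \in H & h C = C' /\ h D = D'.

(** The bound on [#|S|] provides the base pair whose orbit must consist of all pairs of distinct
    points. *)
Lemma ntransitive2P (gT : finGroupType) (T : finType)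
    (to : {action gT &-> T}) (G : {group gT}) (S : {set T}) :
    1 < #|S| -> [acts G, on S | to] ->
  reflect {in S & &, forall a b c, {in S, forall d, a != b -> c != d ->
             exists2 g, g \in G & to a g = c /\ to b g = d}}
          [transitive^2 G, on S | to].
Proof.
have pairS x y : ([tuple x; y] \in 2.-dtuple(S)) = [&& x \in S, y \in S & x != y].
  rewrite !dtuple_on_add !inE memtE subset_all /= !andbT.
  by case: (x \in S); rewrite //= andbC.
move=> S_gt1 actS; apply: (iffP idP) => [tr a b c Sa Sb Sc d Sd neab necd | tr].
  have ab : [tuple a; b] \in 2.-dtuple(S) by rewrite pairS Sa Sb.
  have cd : [tuple c; d] \in 2.-dtuple(S) by rewrite pairS Sc Sd.
  have [g Gg [-> ->]] := atransP2 tr ab cd.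
  by exists g.
have [a [b [Sa Sb neab]]] := card_gt1P S_gt1.
apply/imsetP; exists [tuple a; b]; first by rewrite pairS Sa Sb.
apply/setP=> t; apply/idP/imsetP=> [|[g Gg ->]]; last first.
  by apply: n_act_dtuple; rewrite ?pairS ?Sa ?Sb ?(subsetP actS).
case/tupleP: t => c t; case/tupleP: t => d t; rewrite (tuple0 t) pairS.
case/and3P=> Sc Sd necd; have [g Gg [ac bd]] := tr a b c Sa Sb Sc d Sd neab necd.
by exists g => //; apply: val_inj; rewrite /= ac bd.
Qed.

(* All transpositions are conjugate, hence all lie outside [H]. *)
Lemma index2_Alt (T : finType) (H : {group {perm T}}) :
  #|'Sym_T : H| = 2 -> H :=: 'Alt_T.
Proof.
move=> iH; have nsH : H <| 'Sym_T by apply: index2_normal; rewrite ?subsetT.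
have nH s : s \in 'N(H) by apply: (subsetP (normal_norm nsH)); rewrite inE.
have mulH s t : s \notin H -> t \notin H -> s * t \in H.
  move=> sH tH; have /eqP : #|'Sym_T / H| = 2 by rewrite card_quotient ?normal_norm.
  rewrite (cardsD1 1) group1 eqSS; case/cards1P=> u defu.
  have mem_u w : w \notin H -> coset H w = u.
    move=> wH; apply/set1P; rewrite -defu !inE mem_quotient ?inE // andbT.
    by apply: contraNneq wH => w1; apply: coset_idr.
  have : coset H s = coset H (t^-1) by rewrite !mem_u ?groupV.
  by case/kercoset_rcoset=> // z Hz ->; rewrite mulgKV.
have conj_tperm x y x' y' : x != y -> x' != y' ->
    (tperm x y \in H) = (tperm x' y' \in H).
  move=> nexy nexy'.
  have [s [<- <-]] : exists s : {perm T}, s x = x' /\ s y = y'.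
    exists (tperm x x' * tperm (tperm x x' y) y'); rewrite !permM !tpermL tpermD //.
    - by rewrite -[X in _ != X](tpermL x x') (inj_eq perm_inj) eq_sym.
    - by rewrite eq_sym.
  by rewrite -tpermJ memJ_norm.
have all_tperm x y : x != y -> tperm x y \notin H.
  move=> nexy; apply/negP=> Hxy.
  suff : 'Sym_T \subset H by rewrite -indexg_eq1 iH.
  apply/subsetP=> s _; have [ts -> dts] := prod_tpermP s.
  rewrite big_seq; apply: group_prod => t /(allP dts) dt.
  by rewrite (conj_tperm _ _ x y).
apply/setP=> s; rewrite Alt_even; have [ts -> dts] := prod_tpermP s.
rewrite odd_perm_prod //; elim: ts dts => [|t ts IH] /=; first by rewrite big_nil group1.
case/andP=> /all_tperm tH /IH; rewrite big_cons negbK.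
case: (odd _) => /= [tsH|tsH]; first by rewrite mulH ?tsH.
by apply/negbTE; rewrite groupMr.
Qed.

(** Orbit-stabiliser twice: [H] moves [C] everywhere, and the stabiliser of [C] moves [D] to every
    element other than [C]. *)
Lemma card_two_transitive (W : finType) (H : {group {perm W}}) (C D : W) :
    C != D -> two_transitive H ->
  #|H| = (#|W| * #|W|.-1 * #|'C_('C_H[C | 'P])[D | 'P]|)%N.
Proof.
move=> neCD tH; rewrite -(Lagrange (subsetIl H 'C[C | 'P])) -card_orbit.
have -> : orbit 'P H C = setT.
  apply/setP=> E; rewrite inE; apply/imsetP.
  have [E' neE] : exists E', E != E'.
    by case: (eqVneq E C) => [->|?]; [exists D | exists C].
  by have [h Hh [<- _]] := tH C D E E' neCD neE; exists h.
rewrite -(Lagrange (subsetIl 'C_H[C | 'P] 'C[D | 'P])) -card_orbit.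
have -> : orbit 'P 'C_H[C | 'P] D = [set~ C].
  apply/setP=> E; rewrite !inE; apply/imsetP/idP=> [[h /setIP[Hh /astab1P hC] ->]|neEC].
    by rewrite -[X in _ != X]hC (inj_eq perm_inj) eq_sym.
  rewrite eq_sym in neEC; have [h Hh [hC hD]] := tH C D C E neCD neEC.
  by exists h => //; rewrite inE Hh; apply/astab1P.
by rewrite cardsT cardsC1 mulnC -mulnA; congr (_ * _)%N; rewrite mulnC.
Qed.

Lemma card_Alt4 : #|'Alt_('I_4)| = 12.
Proof. by apply/eqP; rewrite -(@eqn_pmul2l 2) // card_Alt card_ord. Qed.

Lemma card_Sym4 : #|'Sym_('I_4)| = 24.
Proof. by rewrite card_Sym card_ord. Qed.

(** The order is [12 * k] and divides 24, so [k] is 1 or 2, and a subgroup of index two is the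
    alternating group. *)
Lemma perm4_dvdn12_Alt_Sym (H : {group 'S_4}) :
  12 %| #|H| -> H :=: 'Alt_('I_4) \/ H :=: 'Sym_('I_4).
Proof.
move=> H12; have := Lagrange (subsetT H); rewrite -/('Sym_('I_4)) card_Sym4 => iH.
have [k eqk] := dvdnP H12.
move: iH; rewrite eqk mulnAC => /eqP; rewrite -[24]/(2 * 12)%N eqn_pmul2r // => /eqP k2.
have : k <= 2 by apply: dvdn_leq => //; rewrite -k2; apply: dvdn_mulr.
move: eqk k2; case: k => [|[|[|k]]] // eqk k2 _.
- by left; apply: index2_Alt; rewrite mul1n in k2.
- by right; apply/eqP; rewrite eqEcard subsetT card_Sym4 eqk.
Qed.

(** Two-transitivity puts the factor [4 * 3] into the order. Conversely, the alternating group of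
    degree [n] is transitive on [(n - 2)]-tuples of distinct points, here on pairs. *)
Lemma two_transitive_perm4 (H : {group 'S_4}) : two_transitive H <-> 12 %| #|H|.
Proof.
split=> [/(card_two_transitive (isT : @ord0 3 != ord_max)) ->|].
  by rewrite card_ord dvdn_mulr.
suff tA : two_transitive 'Alt_('I_4).
  case/perm4_dvdn12_Alt_Sym=> -> // C D C' D' neCD neCD'.
  by have [h _ hCD] := tA C D C' D' neCD neCD'; exists h; rewrite ?inE.
have actA : [acts 'Alt_('I_4), on [set: 'I_4] | 'P].
  by apply/actsP=> a _ y; rewrite !inE.
have /ntransitive2P tr : [transitive^2 'Alt_('I_4), on [set: 'I_4] | 'P].
  by have := Alt_trans 'I_4; rewrite card_ord.
move=> C D C' D' neCD neCD'.
by apply: tr; rewrite ?inE ?cardsT ?card_ord.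
Qed.

Lemma isog_same_ker (aT rT1 rT2 : finGroupType) (G D1 D2 : {group aT})
    (f1 : {morphism D1 >-> rT1}) (f2 : {morphism D2 >-> rT2}) :
    G \subset D1 -> G \subset D2 -> 'ker_G f1 = 'ker_G f2 ->
  f1 @* G \isog f2 @* G.
Proof.
move=> sGD1 sGD2 eqK; apply: isog_trans (first_isog_loc f2 sGD2).
by rewrite -eqK isog_sym first_isog_loc.
Qed.

(** Numbering the elements of [S] turns an action on a subset into permutations of a full type,
    where the design is studied. *)
Lemma acts_perm_morphism (gT : finGroupType) (T : finType)
    (to : {action gT &-> T}) (G : {group gT}) (S : {set T}) :
    [acts G, on S | to] ->
  exists (e : 'I_#|S| -> T) (f : {morphism G >-> 'S_#|S|}),
    [/\ injective e, forall i, e i \in S, forall x, x \in S -> exists i, e i = x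
      & {in G, forall g i, e (f g i) = to (e i) g}].
Proof.
move=> actS; pose e := @enum_val T (mem S).
have eS i : e i \in S by apply: enum_valP.
have e_inj : injective e by apply: enum_val_inj.
have e_surj x : x \in S -> exists i, e i = x.
  by move=> Sx; exists (enum_rank_in Sx x); apply: enum_rankK_in.
(* For [g] in [G] the search succeeds, so the default [1] is never taken there. *)
pose f g := odflt 1 [pick s : 'S_#|S| | [forall i, e (s i) == to (e i) g]].
have fP : {in G, forall g i, e (f g i) = to (e i) g}.
  move=> g Gg i; rewrite /f; case: pickP => [s /forallP/(_ i)/eqP // | no_s].
  have eg j : exists k, e k == to (e j) g.
    have [|k <-] := e_surj (to (e j) g); last by exists k.
    by rewrite (actsP actS).
  pose h j := xchoose (eg j); have hP j : e (h j) = to (e j) g by apply/eqP/(xchooseP (eg j)).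
  have h_inj : injective h.
    by move=> j k eq_h; apply/e_inj/(act_inj to g); rewrite -!hP eq_h.
  by have /forallP[] := no_s (perm h_inj) => j; rewrite permE hP.
have fM : {in G &, {morph f : g h / g * h}}.
  move=> g h Gg Gh; apply/permP=> i; apply: e_inj.
  by rewrite permM !fP ?groupM // actM.
by exists e, (Morphism fM).
Qed.

(** Elements of cube one induce even permutations of the triple, and the alternating group of degree
    three is cyclic. *)
Lemma commute_order3_on_triple (U : finType) (s t : {perm U}) (Y : {set U}) :
    #|Y| = 3 -> s ^+ 3 = 1 -> t ^+ 3 = 1 ->
    s @: Y = Y -> t @: Y = Y ->
  {in Y, (s * t) =1 (t * s)}.
Proof.
move=> Y3 s3 t3 sY tY.
have actY : [acts <<[set s; t]>>, on Y | 'P].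
  have mem_astabs (u : {perm U}) : u @: Y = Y -> u \in 'N(Y | 'P).
    by move=> uY; rewrite !inE; apply/subsetP=> y Yy; rewrite inE -uY; apply: imset_f.
  by rewrite gen_subG; apply/subsetP=> u /set2P[]->; apply: mem_astabs.
have [e [f [e_inj eY e_surj fP]]] := acts_perm_morphism actY.
have Gs : s \in <<[set s; t]>> by rewrite mem_gen ?set21.
have Gt : t \in <<[set s; t]>> by rewrite mem_gen ?set22.
have even u : u \in <<[set s; t]>> -> u ^+ 3 = 1 -> f u \in 'Alt_('I_#|Y|).
  move=> Gu u3; rewrite Alt_even; have := congr1 (@odd_perm _) (morphX f 3 Gu).
  by rewrite u3 morph1 odd_perm1 !expgS expg0 mulg1 !odd_permM; case: (odd_perm _).
have abA : abelian 'Alt_('I_#|Y|).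
  apply/cyclic_abelian/prime_cyclic.
  suff -> : #|'Alt_('I_#|Y|)| = 3 by [].
  by apply/eqP; rewrite -(@eqn_pmul2l 2) // card_Alt card_ord Y3.
have fE (u : {perm U}) i : u \in <<[set s; t]>> -> u (e i) = e (f u i).
  by move=> Gu; rewrite fP.
move=> y /e_surj[i <-]; rewrite !fE ?groupM // !morphM //.
by rewrite (centsP abA _ (even s Gs s3) _ (even t Gt t3)).
Qed.

Lemma Alt4_order3_not_commute :
  exists s t : 'S_4, [/\ s \in 'Alt_('I_4), t \in 'Alt_('I_4),
                         s ^+ 3 = 1, t ^+ 3 = 1 & s * t != t * s].
Proof.
pose o (k : nat) (lt_k4 : k < 4) : 'I_4 := Ordinal lt_k4.
pose a := @o 0 isT; pose b := @o 1%N isT; pose c := @o 2 isT; pose d := @o 3 isT.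
(* Two 3-cycles through [a] and [b]; their products in the two orders already differ at [a]. *)
exists (tperm a b * tperm a c), (tperm a b * tperm a d).
have cyc3 z : z \in [:: c; d] -> (tperm a b * tperm a z) ^+ 3 = 1.
  move=> cdz; apply/permP=> w; rewrite !expgS expg0 mulg1 !permM perm1 !permE /=.
  by case/or3P: cdz => // /eqP->; apply: val_inj; case: w => [] [|[|[|[|]]]].
rewrite !Alt_even !odd_permM !odd_tperm !cyc3 ?inE ?eqxx //; split=> //.
apply: contraTneq isT => /permP/(_ a)/(congr1 val).
by rewrite !permM !permE.
Qed.

End PermutationGroups.

(** * Double counting in incidence structures *)

Section Incidence.

Variables (U W : finType) (I : U -> W -> bool).

Definition block (C : W) : {set U} := [set x | I x C].
Definition pencil (x : U) : {set W} := [set C | I x C].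

Lemma sum_card_block : \sum_C #|block C| = \sum_x #|pencil x|.
Proof.
under eq_bigr do rewrite -sum1_card big_mkcond.
rewrite exchange_big; apply: eq_bigr => x _; rewrite -sum1_card [RHS]big_mkcond.
by apply: eq_bigr => C _; rewrite !inE.
Qed.

(** Both sides count the pairs [(x, D)] with [x] on both [C] and [D]. *)
Lemma sum_card_meet C :
  \sum_D #|block C :&: block D| = \sum_(x in block C) #|pencil x|.
Proof.
under eq_bigr do rewrite -sum1_card big_mkcond.
rewrite exchange_big [RHS]big_mkcond; apply: eq_bigr => x _.
rewrite -sum1_card; case: ifP => Cx; last by rewrite big1 // => D _; rewrite inE Cx.
by rewrite [RHS]big_mkcond; apply: eq_bigr => D _; rewrite inE Cx !inE.
Qed.

Lemma sum_card_meet_other k r C :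
    (forall D, #|block D| = k) -> (forall x, #|pencil x| = r) ->
  \sum_(D | D != C) #|block C :&: block D| + k = k * r.
Proof.
move=> blockk pencilr; have := sum_card_meet C.
rewrite (bigD1 C) //= setIid blockk addnC => ->.
by under eq_bigr do rewrite pencilr; rewrite sum_nat_const blockk.
Qed.

Lemma card_flags k r :
    (forall D, #|block D| = k) -> (forall x, #|pencil x| = r) ->
  #|U| * r = #|W| * k.
Proof.
move=> blockk pencilr; have := sum_card_block.
rewrite (eq_bigr (fun=> k)) // [RHS](eq_bigr (fun=> r)) // !sum_nat_const.
by [].
Qed.

Lemma card_meet_ge2 C D x y :
  x != y -> I x C -> I x D -> I y C -> I y D -> 1 < #|block C :&: block D|.
Proof. by move=> nexy xC xD yC yD; apply/card_gt1P; exists x, y; rewrite !inE xC xD yC yD. Qed.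

End Incidence.

(** Two blocks through both [x] and [y] would share two points. *)
Lemma card_pencil_meet_le1 (U W : finType) (I : U -> W -> bool) x y :
    (forall C D, C != D -> #|block I C :&: block I D| <= 1) -> x != y ->
  #|pencil I x :&: pencil I y| <= 1.
Proof.
move=> meet1 nexy; rewrite leqNgt; apply/negP=> /card_gt1P[C [D]].
rewrite !inE => -[/andP[xC yC] /andP[xD yD] neCD].
by have := meet1 C D neCD; rewrite leqNgt (card_meet_ge2 nexy).
Qed.

Lemma eq_of_sum_leq (T : finType) (P : pred T) (F : T -> nat) n :
    (forall i, P i -> F i <= n) -> \sum_(i | P i) F i = #|P| * n ->
  forall i, P i -> F i = n.
Proof.
move=> leF sumF i Pi; apply/eqP; rewrite eqn_leq leF //= leqNgt; apply/negP=> ltF.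
have := sumF; rewrite -sum_nat_const [LHS](bigD1 i) // [RHS](bigD1 i) //=.
have : \sum_(j | P j && (j != i)) F j <= \sum_(j | P j && (j != i)) n.
  by apply: leq_sum => j /andP[/leF].
by move=> le_sum eq_sum; have := leq_add ltF le_sum; rewrite addSn eq_sum ltnn.
Qed.

Lemma eq_of_sum_geq (T : finType) (P : pred T) (F : T -> nat) n :
    (forall i, P i -> n <= F i) -> \sum_(i | P i) F i = #|P| * n ->
  forall i, P i -> F i = n.
Proof.
move=> leF sumF i Pi; apply/eqP; rewrite eqn_leq leF // andbT leqNgt; apply/negP=> ltF.
have := sumF; rewrite -sum_nat_const [LHS](bigD1 i) // [RHS](bigD1 i) //=.
have : \sum_(j | P j && (j != i)) n <= \sum_(j | P j && (j != i)) F j.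
  by apply: leq_sum => j /andP[/leF].
by move=> le_sum eq_sum; have := leq_add ltF le_sum; rewrite addSn eq_sum ltnn.
Qed.

Lemma card_predC1 (T : finType) (a : T) : #|fun x => x != a| = #|T|.-1.
Proof. by rewrite -(cardC1 a); apply: eq_card. Qed.

(** Two triples among four points share at least two points, and the meets of [C] with the other
    three blocks sum to 6. Each meet therefore has exactly two points, so no other block has the
    same three. *)
Lemma block_injective_443 (U W : finType) (I : U -> W -> bool) :
    #|U| = 4 -> #|W| = 4 -> (forall C, #|block I C| = 3) ->
    (forall x, #|pencil I x| = 3) -> injective (block I).
Proof.
move=> U4 W4 block3 pencil3 C D eqCD; apply/eqP; rewrite eq_sym; apply: contraTT isT => neDC.
have meet2 E : E != C -> 2 <= #|block I C :&: block I E|.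
  move=> _; have := cardsUI (block I C) (block I E).
  have := max_card (block I C :|: block I E); rewrite U4 !block3; lia.
have sum6 : \sum_(E | E != C) #|block I C :&: block I E| = #|fun E => E != C| * 2.
  by rewrite card_predC1 W4; have := sum_card_meet_other C block3 pencil3; lia.
by have := eq_of_sum_geq meet2 sum6 neDC; rewrite -eqCD setIid block3.
Qed.

(** Handshake lemma: the ordered adjacent pairs split into two equal halves, according to which
    entry has the smaller rank. *)
Lemma even_sum_sym (T : finType) (e : rel T) :
  symmetric e -> irreflexive e -> ~~ odd (\sum_x \sum_y e x y).
Proof.
move=> e_sym e_irr; pose lt (x y : T) := enum_rank x < enum_rank y.
pose S := \sum_x \sum_y (e x y && lt x y).
suff -> : \sum_x \sum_y e x y = S + S by rewrite addnn odd_double.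
rewrite {2}/S [X in _ = _ + X]exchange_big -big_split; apply: eq_bigr => x _ /=.
rewrite -big_split; apply: eq_bigr => y _ /=; rewrite (e_sym y x) /lt.
by case: ltngtP => [||/val_inj/enum_rank_inj ->]; rewrite ?e_irr ?andbT ?andbF ?addn0.
Qed.

(** * Flag-transitive designs with blocks of three points *)

Section Flags.

Variables (gT : finGroupType) (G : {group gT}) (U W : finType).
Variables (f1 : {morphism G >-> {perm U}}) (f2 : {morphism G >-> {perm W}}).
Variables (I : U -> W -> bool) (r : nat).
Hypothesis inv : {in G, forall g x C, I (f1 g x) (f2 g C) = I x C}.
Hypothesis flag : forall x C x' C', I x C -> I x' C' ->
  exists2 g, g \in G & f1 g x = x' /\ f2 g C = C'.
Hypothesis block3 : forall C, #|block I C| = 3.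
Hypothesis pencilr : forall x, #|pencil I x| = r.

Lemma block_act g C : g \in G -> block I (f2 g C) = f1 g @: block I C.
Proof.
move=> Gg; apply/setP=> x; rewrite inE; apply/idP/imsetP=> [xgC | [y]].
  by exists ((f1 g)^-1%g x); rewrite ?permKV // inE -(inv Gg) permKV.
by rewrite inE => yC ->; rewrite inv.
Qed.

Lemma pencil_act g x : g \in G -> pencil I (f1 g x) = f2 g @: pencil I x.
Proof.
move=> Gg; apply/setP=> C; rewrite inE; apply/idP/imsetP=> [xgC | [D]].
  by exists ((f2 g)^-1%g C); rewrite ?permKV // inE -(inv Gg) permKV.
by rewrite inE => xD ->; rewrite inv.
Qed.

(** An element fixing all points fixes the point set of every block, hence every block; the other
    inclusion is dual. *)
Lemma eq_kernels :
  injective (block I) -> injective (pencil I) -> ('ker f1 = 'ker f2)%g.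
Proof.
move=> bI pI; apply/setP=> g; apply/idP/idP=> Kg; have Gg := dom_ker Kg.
  rewrite !inE Gg /=; apply/eqP/permP=> C; apply: bI; rewrite perm1 block_act //.
  by rewrite (mker Kg) -[RHS]imset_id; apply: eq_imset => x; rewrite perm1.
rewrite !inE Gg /=; apply/eqP/permP=> x; apply: pI; rewrite perm1 pencil_act //.
by rewrite (mker Kg) -[RHS]imset_id; apply: eq_imset => C; rewrite perm1.
Qed.

Lemma card_meet_act g C D :
  g \in G -> #|block I (f2 g C) :&: block I (f2 g D)| = #|block I C :&: block I D|.
Proof.
move=> Gg; rewrite !block_act // -imsetI; last by move=> ? ? _ _; apply: perm_inj.
by rewrite card_imset //; apply: perm_inj.
Qed.

(** Meets of size three would make all blocks equal as point sets. Since [r] is the same for all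
    points, every point lies on some block, so there would be only three points. *)
Lemma two_transitive_meet :
    two_transitive (f2 @* G)%g -> 1 < #|W| -> #|U| != 3 ->
  exists2 l, l < 3 & forall C D, C != D -> #|block I C :&: block I D| = l.
Proof.
move=> t2 W2 U3; have [C0 [D0 [_ _ neCD0]]] := card_gt1P W2.
pose l := #|block I C0 :&: block I D0|.
have meet C D : C != D -> #|block I C :&: block I D| = l.
  move=> neCD; have [h /morphimP[g Gg _ ->] [<- <-]] := t2 C0 D0 C D neCD0 neCD.
  exact: card_meet_act.
exists l => //; rewrite ltnNge; apply: contra U3 => l3.
have eqb C : block I C = block I C0.
  have [->//|neC] := eqVneq C C0; apply/eqP; rewrite eqEcard !block3 leqnn andbT.
  by apply/setIidPl/eqP; rewrite eqEcard subsetIl block3 meet.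
rewrite -cardsT -(block3 C0); apply/eqP; congr #|pred_of_set _|; apply/setP=> x; rewrite !inE.
have [y yC0] : exists y, I y C0.
  by have /card_gt0P[y] : 0 < #|block I C0|; [rewrite block3 | rewrite inE; exists y].
have : 0 < #|pencil I x|.
  by rewrite pencilr -(pencilr y); apply/card_gt0P; exists C0; rewrite inE.
by case/card_gt0P=> C; rewrite inE => xC; have /setP/(_ x) := eqb C; rewrite !inE xC.
Qed.

Lemma two_transitive_params :
    two_transitive (f2 @* G)%g -> 1 < #|W| -> #|U| != 3 ->
  [\/ [/\ #|U| = 4, #|W| = 4 & r = 3],
      [/\ #|U| = 6, #|W| = 4, r = 2
        & forall C D, C != D -> #|block I C :&: block I D| = 1],
      [/\ #|U| = 7, #|W| = 7, r = 3
        & forall C D, C != D -> #|block I C :&: block I D| = 1]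
    | r = 1 /\ #|U| = 3 * #|W|].
Proof.
move=> t2 W2 U3; have [l l3 meet] := two_transitive_meet t2 W2 U3.
have flags := card_flags block3 pencilr.
have [C _] : exists C : W, C \in W by apply/card_gt0P; apply: ltnW.
have lW : #|W|.-1 * l + 3 = 3 * r.
  rewrite -(sum_card_meet_other C block3 pencilr); congr (_ + _).
  rewrite (eq_bigr (fun=> l)) => [|D neD]; last by rewrite meet // eq_sym.
  by rewrite sum_nat_const card_predC1.
case: l => [|[|[|l]]] // in l3 meet lW.
- by constructor 4; lia.
- have /card_gt0P[x _] : 0 < #|U|.
    by apply: leq_trans (max_card (block I C)); rewrite block3.
  (* The [r] blocks through [x] share no other point, so they hold [2 * r] points besides [x]. The
     count is carried out in the dual structure. *)
  have U2r : 2 * r + 1 <= #|U|.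
    have le1 : forall C D, C != D -> #|block I C :&: block I D| <= 1.
      by move=> D E neDE; rewrite meet.
    have := @sum_card_meet_other _ _ (fun C x => I x C) r 3 x pencilr block3.
    have : \sum_(y | y != x) #|pencil I x :&: pencil I y| <= \sum_(y | y != x) 1.
      by apply: leq_sum => y; rewrite eq_sym; apply: card_pencil_meet_le1.
    rewrite sum_nat_const muln1 card_predC1 /pencil /block; lia.
  (* Eliminating [#|W| = 3 * r - 2] gives [#|U| * r = 9 * r - 6]; with the bound above,
     [(r - 1) * (r - 3) <= 0]. *)
  have r3 : r <= 3 by nia.
  have : r = 2 \/ r = 3.
    by case: r flags lW U2r r3 => [|[|[|[|]]]]; lia.
  by case=> r_eq; subst r; [constructor 2 | constructor 3]; split=> //; lia.
(* Here [2 * #|U| * r = 9 * r - 3], whence [2 * #|U| < 9]. *)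
- have U4 : #|U| <= 4 by nia.
  constructor 1; move: flags U3 U4.
  by move: #|U| => [|[|[|[|[|]]]]] //; split; lia.
Qed.

Lemma pencil2 x C D : r = 2 -> C != D -> I x C -> I x D -> pencil I x = [set C; D].
Proof.
move=> r2 neCD xC xD; apply/eqP; rewrite eq_sym eqEcard pencilr r2 cards2 neCD andbT.
by apply/subsetP=> E /set2P[]->; rewrite inE.
Qed.

(* Two blocks with two common points would coincide, and [G] would preserve
   the resulting partition of the points into two triples; elements of order 3
   preserving it commute, unlike those of [A_4]. *)
Lemma card_meet_642 :
    #|U| = 6 -> #|W| = 4 -> r = 2 ->
    (exists s t, [/\ s \in f1 @* G, t \in f1 @* G,
                     s ^+ 3 = 1, t ^+ 3 = 1 & s * t != t * s]%g) ->
  forall C D, C != D -> #|block I C :&: block I D| = 1.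
Proof.
move=> U6 W4 r2 [s [t [Gs Gt s3 t3]]].
(* The meets of [C] with the other three blocks sum to 3, so the upper bound one for each of them
   suffices. *)
suff meet1 C D : C != D -> (s * t)%g != (t * s)%g -> #|block I C :&: block I D| <= 1.
  move=> nst C D neCD; rewrite eq_sym in neCD.
  have le1 E : E != C -> #|block I C :&: block I E| <= 1 by rewrite eq_sym => /meet1; apply.
  apply: (eq_of_sum_leq le1) neCD.
  by rewrite card_predC1 W4; have := sum_card_meet_other C block3 pencilr; rewrite r2; lia.
move=> neCD; rewrite leqNgt; apply: contra => meet2; apply/eqP.
(* Given [z] on [C], move a common point of [C] and [D] to [z] while fixing [C]. The image of [D]
   again shares two points with [C], so some [w] on [C] lies on [D] and on its image. Only two
   blocks pass through [w], so the image is [D] itself and [z] is on [D]. *)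
have eqCD : block I C = block I D.
  apply/eqP; rewrite eqEcard !block3 leqnn andbT; apply/subsetP=> z.
  rewrite !inE => zC; have /card_gt0P[x] : 0 < #|block I C :&: block I D| by apply: ltnW.
  rewrite !inE => /andP[xC xD]; have [g Gg [xz CC]] := flag xC zC.
  have zD' : I z (f2 g D) by rewrite -xz inv.
  have neCD' : C != f2 g D by rewrite -CC (inj_eq perm_inj).
  have meet2' : 1 < #|block I C :&: block I (f2 g D)|.
    by rewrite -{1}CC card_meet_act.
  have /card_gt0P[w] : 0 < #|(block I C :&: block I D) :&: (block I C :&: block I (f2 g D))|.
    have := cardsUI (block I C :&: block I D) (block I C :&: block I (f2 g D)).
    have : #|(block I C :&: block I D) :|: (block I C :&: block I (f2 g D))| <= #|block I C|.
      by apply: subset_leq_card; rewrite subUset !subsetIl.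
    by rewrite block3; lia.
  rewrite !inE => /andP[/andP[wC wD] /andP[_ wD']].
  have := pencil2 r2 neCD wC wD => /setP/(_ (f2 g D)); rewrite !inE wD' eq_sym (negbTE neCD').
  by move/esym/eqP=> DD; rewrite -DD.
pose Y := block I C; have Y3 : #|Y| = 3 by apply: block3.
(* If the image of [Y] meets [Y] in [w], it is one of the two blocks [C] and [D] through [w], both
   of which are [Y] as point sets. *)
have Yact h : h \in (f1 @* G)%g -> h @: Y = Y \/ h @: Y = ~: Y.
  case/morphimP=> g Gg _ ->; rewrite -block_act //.
  have [Ydis|] := boolP [disjoint block I (f2 g C) & Y].
    right; apply/eqP; rewrite eqEcard subsets_disjoint setCK Ydis /=.
    by rewrite block3 cardsCs setCK U6 Y3.
  case/pred0Pn=> w /andP[/=]; rewrite !inE => wg wC; left.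
  have wD : I w D by move/setP/(_ w): eqCD; rewrite !inE wC.
  have := pencil2 r2 neCD wC wD => /setP/(_ (f2 g C)); rewrite !inE wg.
  by case/esym/orP=> /eqP->.
have imY2 (h : {perm U}) : (h ^+ 2)%g @: Y = h @: (h @: Y).
  by rewrite -imset_comp; apply: eq_imset => x; rewrite /= expgS expg1 permM.
have stabY h : h \in (f1 @* G)%g -> (h ^+ 3 = 1)%g -> h @: Y = Y.
  move=> Gh h3; case: (Yact h Gh) => // hY.
  have : (h ^+ 3)%g @: Y = h @: ((h ^+ 2)%g @: Y).
    by rewrite -imset_comp; apply: eq_imset => x; rewrite /= expgSr permM.
  have -> : (h ^+ 3)%g @: Y = Y.
    by rewrite h3 -[RHS]imset_id; apply: eq_imset => x; rewrite perm1.
  case: (Yact (h ^+ 2)%g (groupX 2 Gh)) => [-> //|h2Y] _.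
  by apply: (imset_inj (@perm_inj _ h)); rewrite -imY2 h2Y hY.
have stabC (h : {perm U}) : h @: Y = Y -> h @: (~: Y) = ~: Y.
  move=> hY; apply/eqP; rewrite eqEcard card_imset ?leqnn ?andbT; last exact: perm_inj.
  apply/subsetP=> _ /imsetP[z + ->]; rewrite !in_setC; apply: contra.
  by rewrite -{1}hY => /imsetP[y Yy /perm_inj ->].
have [sY tY] := (stabY s Gs s3, stabY t Gt t3).
have Z3 : #|~: Y| = 3 by rewrite cardsCs setCK U6 Y3.
apply/permP=> x; case: (boolP (x \in Y)) => Yx.
  exact: (commute_order3_on_triple Y3 s3 t3).
by apply: (commute_order3_on_triple Z3 s3 t3); rewrite ?stabC // inE.
Qed.

Lemma flag_transitive_blocks C C' : exists2 g, g \in G & f2 g C = C'.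
Proof.
have inC D : exists x, I x D.
  by have /card_gt0P[y] : 0 < #|block I D|; [rewrite block3 | rewrite inE; exists y].
have [[x xC] [y yC]] := (inC C, inC C').
by have [g Gg [_ gC]] := flag xC yC; exists g.
Qed.

(* Let [n i C] be the number of blocks meeting [C] in [i] points.  Blocks are
   distinct because 7 is prime, so [n 1 C + 2 * n 2 C = 6]; flag-transitivity makes
   3 divide [n 1 C], and the handshake lemma makes [n 2 C] even. *)
Lemma card_meet_773 :
    #|U| = 7 -> #|W| = 7 -> r = 3 ->
  forall C D, C != D -> #|block I C :&: block I D| = 1.
Proof.
move=> U7 W7 r3; pose m C D := #|block I C :&: block I D|.
have mCC C : m C C = 3 by rewrite /m setIid block3.
have mC C D : m C D = m D C by rewrite /m setIC.
have sum6 C : \sum_(D | D != C) m C D = 6.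
  by have := sum_card_meet_other C block3 pencilr; rewrite r3 /m; lia.
pose c C := #|[set D | block I C == block I D]|.
have c_const C C' : c C = c C'.
  have [g Gg <-] := flag_transitive_blocks C C'.
  rewrite /c -(card_imset _ (@perm_inj _ (f2 g))); apply: eq_card => D.
  rewrite inE; apply/imsetP/eqP=> [[E + ->]|eqD].
    by rewrite inE !block_act // => /eqP->.
  exists ((f2 g)^-1%g D); rewrite ?permKV // inE; apply/eqP.
  by apply: (imset_inj (@perm_inj _ (f1 g))); rewrite -!block_act // permKV.
have bI : injective (block I).
  move=> C D eqCD.
  have := card_uniform_partition (n := c C) _ (preim_partitionP (block I) [set: W]).
  rewrite cardsT W7 => card7.
  have /card7 : {in preim_partition (block I) [set: W], forall A : {set W}, #|A| = c C}.
    move=> A /imsetP[E _ ->]; rewrite (c_const C E); apply: eq_card => F; by rewrite !inE.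
  move/esym/(congr1 (dvdn (c C))); rewrite dvdn_mull // => /esym.
  rewrite dvdn_divisors // -[divisors 7]/[:: 1; 7] !inE => /orP[] /eqP cC.
    have /eqP/cards1P[E defE] := cC.
    have : C \in [set D | block I C == block I D] by rewrite inE.
    have : D \in [set D | block I C == block I D] by rewrite inE eqCD.
    by rewrite defE !inE => /eqP-> /eqP.
  (* Seven equal blocks would make the six meets with [C] sum to 18. *)
  suff : #|W|.-1 * 3 = 6 by rewrite W7.
  rewrite -(sum6 C) -(card_predC1 C) -sum_nat_const; apply: eq_bigr => E _.
  have : [set D | block I C == block I D] = setT.
    by apply/eqP; rewrite eqEcard subsetT cardsT W7 -cC leqnn.
  by move/setP/(_ E); rewrite !inE /m => /eqP<-; rewrite setIid block3.
have m3 C D : D != C -> m C D <= 2.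
  move=> neDC; rewrite leqNgt; apply: contra neDC => m3; apply/eqP/esym/bI/eqP.
  rewrite eqEcard !block3 leqnn andbT.
  by apply/setIidPl/eqP; rewrite eqEcard subsetIl block3.
(* The term [D = C] contributes only for [i = 3]. *)
pose n i C := \sum_D (m C D == i).
have n_const i C C' : n i C = n i C'.
  have [g Gg <-] := flag_transitive_blocks C C'.
  rewrite /n [RHS](reindex_inj (@perm_inj _ (f2 g))); apply: eq_bigr => D _.
  by rewrite /m card_meet_act.
have n2even C : ~~ odd (n 2 C).
  have := @even_sum_sym W (fun C D => m C D == 2).
  rewrite (eq_bigr (fun=> n 2 C)) => [|D _]; last exact: n_const.
  rewrite sum_nat_const W7 oddM /=; apply=> [D E|D]; first by rewrite mC.
  by rewrite mCC.
have n1dvd C : 3 %| n 1 C.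
  (* The stabiliser of [C] is transitive on the points of [C], so the number [a x] of blocks meeting
     [C] only in [x] does not depend on [x], and [n 1 C] is three times it. *)
  pose a x := \sum_D (I x D && (m C D == 1)).
  have -> : n 1 C = \sum_(x in block I C) a x.
    rewrite exchange_big; apply: eq_bigr => D _; have [mD|_] := eqVneq; last first.
      by rewrite big1 // => x _; rewrite andbF.
    rewrite -[LHS]mD /m -sum1_card big_mkcond [RHS]big_mkcond; apply: eq_bigr => x _.
    by rewrite !inE andbT; case: (I x C); case: (I x D).
  have a_const : {in block I C &, forall x y, a x = a y}.
    move=> x y; rewrite !inE => xC yC; have [g Gg [<- gC]] := flag xC yC.
    rewrite /a [RHS](reindex_inj (@perm_inj _ (f2 g))); apply: eq_bigr => D _.
    by rewrite inv // /m -{2}gC card_meet_act.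
  have /card_gt0P[y yC] : 0 < #|block I C| by rewrite block3.
  rewrite (eq_bigr (fun=> a y)) => [|x xC]; last exact: a_const.
  by rewrite sum_nat_const block3 dvdn_mulr.
have n12 C : n 1 C + 2 * n 2 C = 6.
  rewrite -(sum6 C) /n big_distrr -big_split [LHS](bigD1 C) //= mCC.
  by apply: eq_bigr => D neDC; case: (m C D) (m3 C D neDC) => [|[|[|]]].
(* The value 0 would make [n 2 C] the odd number 3, and the value 3 has the wrong parity. *)
have n1 C : n 1 C = 6.
  by have := n12 C; have := n2even C; have /dvdnP[k ->] := n1dvd C; lia.
have n2 C : n 2 C = 0 by have := n12 C; rewrite n1; lia.
have le1 C D : D != C -> m C D <= 1.
  move=> neDC; have := m3 C D neDC; rewrite leq_eqVlt => /predU1P[m2|//].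
  by have /eqP := n2 C; rewrite /n sum_nat_eq0 => /forall_inP/(_ D isT); rewrite m2.
move=> C D; rewrite eq_sym => neDC; apply: (eq_of_sum_leq (le1 C)) neDC.
by rewrite sum6 card_predC1 W7.
Qed.

End Flags.

(** * Coordinates over the field of two elements on a Fano plane *)

Section Fano.

Import GRing.Theory.
Local Open Scope ring_scope.

Variables (U W : finType) (I : U -> W -> bool).
Hypothesis U7 : #|U| = 7%N.
Hypothesis block3 : forall C, #|block I C| = 3%N.
Hypothesis pencil3 : forall x, #|pencil I x| = 3%N.
Hypothesis meet1 : forall C D, C != D -> #|block I C :&: block I D| = 1%N.

Lemma fano_line_unique x y C D :
  x != y -> I x C -> I y C -> I x D -> I y D -> C = D.
Proof.
move=> nexy xC yC xD yD; apply/eqP; apply: contraT => neCD.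
by have := card_meet_ge2 nexy xC xD yC yD; rewrite meet1.
Qed.

Lemma fano_point_unique x y C D :
  C != D -> I x C -> I y C -> I x D -> I y D -> x = y.
Proof.
move=> neCD xC yC xD yD; apply/eqP; apply: contraT => nexy.
by rewrite (fano_line_unique nexy xC yC xD yD) eqxx in neCD.
Qed.

Lemma fano_meet C D : C != D -> exists2 p, I p C & I p D.
Proof.
move=> /meet1 m1; have /card_gt0P[p] : (0 < #|block I C :&: block I D|)%N by rewrite m1.
by rewrite !inE => /andP[]; exists p.
Qed.

(** The three lines through [x] carry two further points each. Two points share at most one line, so
    each of the six other points is reached exactly once. *)
Lemma card_pencil_meet x y : x != y -> #|pencil I x :&: pencil I y| = 1%N.
Proof.
have le1 z : z != x -> (#|pencil I x :&: pencil I z| <= 1)%N.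
  rewrite eq_sym; apply: card_pencil_meet_le1 => C D neCD; by rewrite meet1.
rewrite eq_sym; apply: (eq_of_sum_leq le1); rewrite card_predC1 U7.
have := @sum_card_meet_other _ _ (fun C x => I x C) 3 3 x pencil3 block3.
by rewrite /block /pencil; lia.
Qed.

Lemma fano_join x y : x != y -> exists2 C, I x C & I y C.
Proof.
move=> /card_pencil_meet m1.
have /card_gt0P[C] : (0 < #|pencil I x :&: pencil I y|)%N by rewrite m1.
by rewrite !inE => /andP[]; exists C.
Qed.

Lemma fano_third x y C : x != y -> I x C -> I y C ->
  exists z, [/\ z != x, z != y, I z C & block I C = [set x; y; z]].
Proof.
move=> nexy xC yC; have : #|block I C :\: [set x; y]| = 1%N.
  rewrite cardsD block3 (setIidPr _) ?cards2 ?nexy //.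
  by apply/subsetP=> w /set2P[]->; rewrite inE.
case/eqP/cards1P=> z defz; have : z \in block I C :\: [set x; y] by rewrite defz set11.
rewrite !inE negb_or => /andP[/andP[zx zy] zC]; exists z; split=> //.
rewrite -(setID (block I C) [set x; y]) defz (setIidPr _) //.
by apply/subsetP=> w /set2P[]->; rewrite inE.
Qed.

Notation V := 'rV['F_2]_3.

Lemma F2_cases (a : 'F_2) : a = 0 \/ a = 1.
Proof. by case: a => -[|[|]] // i; [left | right]; apply: val_inj. Qed.

Lemma addrr_rV2 (w : V) : w + w = 0.
Proof.
apply/rowP=> i; rewrite !mxE; case: (F2_cases (w 0 i)) => ->; by apply: val_inj.
Qed.

(** An identification with the projective plane over ['F_2]: with seven points, [c] is automatically
    onto the nonzero vectors. *)
Definition fano_coord (c : U -> V) :=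
  [/\ injective c, forall x, c x != 0
    & forall C, \sum_(x in block I C) c x = 0].

(** The complement of a line is the support of a linear form, so each coordinate is 1 off its line;
    a point gets the zero vector only if it lies on all three lines. *)
Definition line_coord (L : 'I_3 -> W) (x : U) : V := \row_i (~~ I x (L i))%:R.

(** Summed over the points of [C], coordinate [i] counts the points of [C] off [L i], which are none
    or two. If [x] and [y] had the same coordinates, the third point of their join would have
    coordinates zero. *)
Lemma line_coordP L : (forall x, exists i, ~~ I x (L i)) -> fano_coord (line_coord L).
Proof.
move=> Lnc; have sum0 C : \sum_(x in block I C) line_coord L x = 0.
  apply/rowP=> i; rewrite summxE mxE.
  have -> : \sum_(x in block I C) line_coord L x 0 i = #|block I C :\: block I (L i)|%:R.
    rewrite -sum1_card natr_sum [RHS]big_mkcond [LHS]big_mkcond; apply: eq_bigr => x _.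
    by rewrite mxE !inE; case: (I x C); case: (I x (L i)).
  rewrite cardsD block3; have [<-|neCL] := eqVneq C (L i).
    by rewrite setIid block3.
  by rewrite meet1 //; apply: val_inj.
have nz x : line_coord L x != 0.
  have [i xL] := Lnc x; apply/eqP=> /rowP/(_ i); rewrite !mxE xL; exact/eqP.
split=> // x y eqxy; apply/eqP; apply: contraT => nexy.
have [C xC yC] := fano_join nexy; have [z [zx zy zC defC]] := fano_third nexy xC yC.
have := sum0 C; rewrite defC setUC big_setU1 /= ?big_setU1 ?big_set1 ?inE //= ?negb_or ?zx //.
by rewrite eqxy addrr_rV2 addr0 => z0; have := nz z; rewrite z0 eqxx.
Qed.

Lemma fano_coord_third c x y z C : fano_coord c ->
  x != y -> z != x -> z != y -> block I C = [set x; y; z] -> c z = c x + c y.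
Proof.
case=> _ _ /(_ C) + nexy zx zy defC; rewrite defC setUC.
rewrite big_setU1 /= ?big_setU1 ?big_set1 ?inE //= ?negb_or ?zx //.
by move/(congr1 (+%R^~ (c x + c y))); rewrite add0r -addrA addrr_rV2 addr0.
Qed.

Lemma fano_coord_surj c u : fano_coord c -> u != 0 -> exists x, c x = u.
Proof.
case=> c_inj c_nz _ u_nz.
suff : u \in c @: [set: U] by case/imsetP=> x _ ->; exists x.
suff -> : c @: [set: U] = [set~ 0] by rewrite !inE.
apply/eqP; rewrite eqEcard card_imset // cardsT U7 cardsC1 card_mx card_Fp // andbT.
by apply/subsetP=> _ /imsetP[x _ ->]; rewrite !inE.
Qed.

(** In either system the third point of a line is the sum of the other two, so the induced map on
    vectors is additive; over ['F_2] additive maps are linear. *)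
Lemma fano_coord_change c c' : fano_coord c -> fano_coord c' ->
  exists A : 'M['F_2]_3, forall x, c' x = c x *m A.
Proof.
move=> cP c'P; have [c_inj c_nz _] := cP.
(* By injectivity of [c] at most one term is nonzero; none is when [u = 0]. *)
pose phi u : V := \sum_x (if c x == u then c' x else 0).
have phiE x : phi (c x) = c' x.
  rewrite /phi (bigD1 x) //= eqxx big1 ?addr0 // => y neyx.
  by rewrite (inj_eq c_inj) (negbTE neyx).
have phi0 : phi 0 = 0.
  by rewrite /phi big1 // => x _; rewrite (negbTE (c_nz x)).
have phiD : {morph phi : u v / u + v}.
  move=> u v; have [->|nzu] := eqVneq u 0; first by rewrite phi0 !add0r.
  have [->|nzv] := eqVneq v 0; first by rewrite phi0 !addr0.
  have [->|neuv] := eqVneq u v; first by rewrite !addrr_rV2.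
  have [[x cx] [y cy]] := (fano_coord_surj cP nzu, fano_coord_surj cP nzv).
  have nexy : x != y by apply: contraNneq neuv => eqxy; rewrite -cx -cy eqxy.
  have [C xC yC] := fano_join nexy; have [z [zx zy zC defC]] := fano_third nexy xC yC.
  rewrite -cx -cy -(fano_coord_third cP nexy zx zy defC) !phiE.
  exact: fano_coord_third c'P nexy zx zy defC.
exists (\matrix_i phi (delta_mx 0 i)) => x; rewrite -phiE mulmx_sum_row.
rewrite {1}(row_sum_delta (c x)) (big_morph phi phiD phi0); apply: eq_bigr => i _.
by rewrite rowK; case: (F2_cases (c x 0 i)) => ->; rewrite ?scale0r ?scale1r.
Qed.

Lemma fano_coord_span c (A B : 'M['F_2]_3) : fano_coord c ->
  (forall x, c x *m A = c x *m B) -> A = B.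
Proof.
move=> cP eqAB; apply/row_matrixP=> i; rewrite !rowE.
have [|x <-] := fano_coord_surj (u := delta_mx 0 i) cP; last exact: eqAB.
apply/eqP=> /rowP/(_ i); rewrite !mxE !eqxx; exact/eqP.
Qed.

Lemma fano_coord_GL c c' : fano_coord c -> fano_coord c' ->
  exists A : {'GL_3['F_2]}, forall x, c' x = c x *m GLval A.
Proof.
move=> cP c'P; have [A cA] := fano_coord_change cP c'P.
have [B c'B] := fano_coord_change c'P cP.
have AB1 : A *m B = 1%:M.
  by apply: (fano_coord_span cP) => x; rewrite mulmxA -cA -c'B mulmx1.
have [uA _] := mulmx1_unit AB1.
by exists (FinRing.unit _ uA).
Qed.

End Fano.

(** * The groups GL(3,2), SL(3,2) and PSL(3,2) coincide and have order 168 *)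

Section PSL32.

Import GRing.Theory.
Local Open Scope group_scope.

Lemma card_GL32 : #|[set: {'GL_3['F_2]}]| = 168.
Proof.
have := @card_GL 'F_2 3 isT; rewrite /GLgroup => ->.
by rewrite card_Fp // big_nat_recr // big_nat_recr // big_nat1.
Qed.

Lemma SL32 : SL 3 'F_2 = [set: {'GL_3['F_2]}].
Proof.
apply/setP=> A; rewrite !inE.
by case: (F2_cases (\det (GLval A))%R) (GL_det A) => -> //; rewrite eqxx.
Qed.

(** A central matrix commutes with the transvections, hence with all off-diagonal matrix units, so
    it is scalar; the only invertible scalar over ['F_2] is 1. *)
Lemma center_SL32 : 'Z(SL 3 'F_2) = 1.
Proof.
apply/trivgP/subsetP=> A /setIP[_ /centP cA]; apply/set1P/val_inj.
pose M : 'M['F_2]_3 := GLval A.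
have comE i j : i != j -> (M *m delta_mx i j = delta_mx i j *m M)%R.
  (* In characteristic two the transvection [E] is its own inverse. *)
  move=> neij; pose E : 'M['F_2]_3 := (1%:M + delta_mx i j)%R.
  have EE : (E *m E = 1%:M)%R.
    rewrite /E mulmxDl mul1mx mulmxDr mulmx1 mul_delta_mx_0 1?eq_sym // addr0.
    rewrite -addrA (_ : delta_mx i j + delta_mx i j = 0)%R ?addr0 //.
    by apply/matrixP=> k l; rewrite !mxE; case: (_ && _); apply: val_inj.
  have [uE _] := mulmx1_unit EE; pose e : {'GL_3['F_2]} := FinRing.unit _ uE.
  have eSL : e \in SL 3 'F_2 by rewrite SL32 inE.
  have /(congr1 GLval) := cA e eSL.
  rewrite !GL_MxE -/M -[GLval e]/E /E mulmxDl mulmxDr mulmx1 mul1mx.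
  by move/addrI.
have entry i j k : i != j -> M k i = (M j j *+ (k == i))%R.
  move=> neij; have /matrixP/(_ k j) := comE i j neij; rewrite !mxE.
  rewrite (bigD1 i) //= big1 => [|l neli]; last by rewrite mxE (negbTE neli) mulr0.
  rewrite mxE !eqxx mulr1 addr0 => ->; rewrite (bigD1 j) //= big1 => [|l nelj].
    by rewrite mxE eqxx andbT mulr_natl addr0; case: (k == i).
  by rewrite mxE (negbTE nelj) andbF mul0r.
have other (i : 'I_3) : exists j, i != j.
  by case: (eqVneq i ord0) => [->|?]; [exists ord_max | exists ord0].
have diag1 i : M i i = 1%R.
  case: (F2_cases (M i i)) => // Mi0; have := GL_unitmx A; rewrite -[val A]/M.
  suff -> : M = 0%R by rewrite unitmxE det0 unitr0.
  apply/matrixP=> k l; rewrite mxE; have [j nelj] := other l.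
  have [eqli | neli] := eqVneq l i.
    rewrite eqli in nelj *; rewrite (entry i j k nelj).
    by have := entry i j i nelj; rewrite Mi0 eqxx mulr1n => <-; rewrite mul0rn.
  by rewrite (entry l i k neli) Mi0 mul0rn.
apply/matrixP=> k l; have [j nelj] := other l.
by rewrite -[RHS]/((1%:M : 'M['F_2]_3)%R k l) -[LHS]/(M k l) (entry l j k nelj) diag1 mxE.
Qed.

Lemma PSL32_isog : PSL 3 'F_2 \isog [set: {'GL_3['F_2]}].
Proof. by rewrite /PSL center_SL32 SL32 isog_sym quotient1_isog. Qed.

End PSL32.

Lemma GLval_inj n (F : finComUnitRingType) : injective (@GLval n F).
Proof. exact: val_inj. Qed.

(** * Flag-transitive groups of a Fano plane *)

Section FanoGroup.

Local Open Scope group_scope.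

Variables (gT : finGroupType) (G : {group gT}) (U W : finType).
Variables (f1 : {morphism G >-> {perm U}}) (f2 : {morphism G >-> {perm W}}).
Variables (I : U -> W -> bool).
Hypothesis inv : {in G, forall g x C, I (f1 g x) (f2 g C) = I x C}.
Hypothesis flag : forall x C x' C', I x C -> I x' C' ->
  exists2 g, g \in G & f1 g x = x' /\ f2 g C = C'.
Hypotheses (U7 : #|U| = 7%N) (W7 : #|W| = 7%N).
Hypothesis block3 : forall C, #|block I C| = 3%N.
Hypothesis pencil3 : forall x, #|pencil I x| = 3%N.
Hypothesis meet1 : forall C D, C != D -> #|block I C :&: block I D| = 1%N.

Let line_unique := fano_line_unique meet1.
Let point_unique := fano_point_unique meet1.
Let meet := fano_meet meet1.
Let join := fano_join U7 block3 pencil3 meet1.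

Lemma fano_block_inj : injective (block I).
Proof.
move=> C D eqCD; apply/eqP; apply: contraT => /meet1.
by rewrite eqCD setIid block3.
Qed.

Lemma fano_pencil_inj : injective (pencil I).
Proof.
move=> x y eqxy; apply/eqP; apply: contraT => /(card_pencil_meet U7 block3 pencil3 meet1).
by rewrite eqxy setIid pencil3.
Qed.

Let eqK : 'ker f1 = 'ker f2 := eq_kernels inv fano_block_inj fano_pencil_inj.

Lemma fano_line_off p : exists M, ~~ I p M.
Proof.
have /subsetPn[M _] : ~~ ([set: W] \subset pencil I p).
  by apply/negP=> /subset_leq_card; rewrite cardsT W7 pencil3.
by rewrite inE; exists M.
Qed.

(** The third line is any line missing the common point of [C] and [D]. *)
Lemma fano_nonconcurrent C D : C != D -> exists L : 'I_3 -> W,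
  [/\ L ord0 = C, L (inord 1) = D & forall x, exists i, ~~ I x (L i)].
Proof.
move=> neCD; have [p pC pD] := meet neCD; have [E pE] := fano_line_off p.
exists (fun i => nth C [:: C; D; E] i); split=> // [|x]; first by rewrite inordK.
have [xC|] := boolP (I x C); last by exists ord0.
have [xD|] := boolP (I x D); last by exists (inord 1); rewrite inordK.
by exists ord_max; rewrite /= (point_unique neCD xC pC xD pD).
Qed.

Lemma fano_coord_act c g : g \in G -> fano_coord I c -> fano_coord I (c \o f1 g).
Proof.
move=> Gg [c_inj c_nz c_sum]; split=> [x y /c_inj/perm_inj //|x|C]; first exact: c_nz.
by have := c_sum (f2 g C); rewrite (block_act inv) // big_imset // => ? ? _ _ /perm_inj.
Qed.

(** Both [c] and [c \o f1 g] are coordinate systems, so a matrix takes one to the other. It is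
    unique because the coordinates span, which makes [rho] multiplicative. *)
Lemma fano_rep c : fano_coord I c -> exists rho : {morphism G >-> {'GL_3['F_2]}},
  {in G, forall g x, c (f1 g x) = (c x *m GLval (rho g))%R} /\ 'ker rho = 'ker f1.
Proof.
move=> cP; have [c_inj _ _] := cP; pose rho g : {'GL_3['F_2]} := odflt 1
  [pick A : {'GL_3['F_2]} | [forall x, c (f1 g x) == (c x *m GLval A)%R]].
have rhoP : {in G, forall g x, c (f1 g x) = (c x *m GLval (rho g))%R}.
  move=> g Gg x; rewrite /rho; case: pickP => [A /forallP/(_ x)/eqP //|no_A].
  have [A cA] := fano_coord_GL U7 block3 pencil3 meet1 cP (fano_coord_act Gg cP).
  by have /forallP[] := no_A A => y; apply/eqP/cA.
have rhoM : {in G &, {morph rho : g h / g * h}}.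
  move=> g h Gg Gh; apply: GLval_inj; apply: (fano_coord_span U7 cP) => x.
  by rewrite GL_MxE mulmxA -!rhoP ?groupM // morphM // permM.
exists (Morphism rhoM); split=> //; apply/setP=> g; apply/idP/idP=> Kg.
  have Gg := dom_ker Kg; rewrite !inE Gg; apply/eqP/permP=> x; apply: c_inj.
  by rewrite rhoP // -[rho g]/(Morphism rhoM g) (mker Kg) mulmx1 perm1.
have Gg := dom_ker Kg; rewrite !inE Gg; apply/eqP/GLval_inj.
apply: (fano_coord_span U7 cP) => x.
by rewrite -rhoP // (mker Kg) perm1 GL_1E mulmx1.
Qed.

(** Complete both pairs to triangles of lines. The matrix between the two coordinate systems is in
    the image of [rho], which by its order is the whole linear group. *)
Lemma fano_two_transitive : #|f1 @* G| = 168 -> two_transitive (f2 @* G).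
Proof.
move=> G168 C D C' D' neCD neCD'.
have [L [L0 L1 Lnc]] := fano_nonconcurrent neCD.
have [L' [L0' L1' Lnc']] := fano_nonconcurrent neCD'.
have cP := line_coordP U7 block3 pencil3 meet1 Lnc.
have cP' := line_coordP U7 block3 pencil3 meet1 Lnc'.
have [rho [rhoP rhoK]] := fano_rep cP'.
have [A cA] := fano_coord_GL U7 block3 pencil3 meet1 cP' cP.
have : A \in rho @* G.
  suff -> : rho @* G = [set: {'GL_3['F_2]}] by rewrite inE.
  have isoG : rho @* G \isog f1 @* G by apply: isog_same_ker; rewrite ?subxx ?rhoK.
  by apply/eqP; rewrite eqEcard subsetT card_GL32 -G168 (card_isog isoG) leqnn.
case/morphimP=> g Gg _ defA; exists (f2 g); first exact: mem_morphim.
have IL i x : I (f1 g x) (L' i) = I x (L i).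
  have /rowP/(_ i) : line_coord I L' (f1 g x) = line_coord I L x by rewrite rhoP // -defA -cA.
  by rewrite !mxE; case: (I _ (L' i)); case: (I x (L i)) => //= /eqP.
have fL i : f2 g (L i) = L' i.
  apply: fano_block_inj; apply/setP=> x; rewrite !inE.
  by rewrite -(permKV (f1 g) x) inv // IL.
by rewrite -L0 -L1 -L0' -L1' !fL.
Qed.

(* [p] is the centre of the elation and [A] its axis. *)
Lemma fano_elation (s : {perm U}) (t : {perm W}) :
    (forall x C, I (s x) (t C) = I x C) -> involutive s -> involutive t -> s != 1 ->
  exists p q A, [/\ p != q, I p A, I q A, s q = q & forall M, (t M == M) = I p M].
Proof.
move=> st sK tK /eqP s1.
have [x0 sx0] : exists x0, s x0 != x0.
  apply/existsP; apply: contraT; rewrite negb_exists => /forallP fix_s.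
  by case: s1; apply/permP=> x; rewrite perm1; apply/eqP/negPn.
(* [s] swaps [x] and [s x], so it preserves the line joining them. *)
have join_fixed x M : s x != x -> I x M -> I (s x) M -> t M = M.
  move=> sx xM sxM; apply: (line_unique sx _ _ sxM xM); first by rewrite st.
  by rewrite -{1}(sK x) st.
have meet_fixed x M N : M != N -> I x M -> I x N -> t M = M -> t N = N -> s x = x.
  move=> neMN xM xN tM tN.
  by apply: (point_unique neMN _ xM _ xN); [rewrite -tM st | rewrite -tN st].
have [M0 x0M sx0M] := join sx0.
have [p [px0 psx0 pM defM0]] := fano_third block3 sx0 x0M sx0M.
have tM0 : t M0 = M0 by apply: (@join_fixed x0).
have M0P q : I q M0 -> [|| q == s x0, q == x0 | q == p].
  by move/setP/(_ q): defM0; rewrite !inE -orbA => ->.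
have sp : s p = p.
  have /or3P[/eqP|/eqP|/eqP//] : [|| s p == s x0, s p == x0 | s p == p].
  - by apply: M0P; rewrite -tM0 st.
  - by move/perm_inj/eqP; rewrite (negbTE psx0).
  by move=> spx0; rewrite -spx0 sK eqxx in px0.
have fixM0 q : I q M0 -> s q = q -> q = p.
  case/M0P/or3P=> /eqP -> //; last by move/eqP; rewrite (negbTE sx0).
  by rewrite sK => /eqP; rewrite eq_sym (negbTE sx0).
(* A fixed line other than [M0] meets [M0] in a fixed point, and [p] is the only one there. *)
have fixed_through M : t M = M -> I p M.
  move=> tM; have [-> //|neM] := eqVneq M M0; have [q qM qM0] := meet neM.
  by rewrite -(fixM0 q qM0 (meet_fixed q M M0 neM qM qM0 tM tM0)).
(* On a moved line [M] through [p], any [x] other than [p] is moved. The join of [x] and [s x] is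
   fixed, so it passes through [p] and equals [M]. *)
have through_fixed M : I p M -> t M = M.
  move=> pM'; apply/eqP; apply: contraT => tM.
  have [x] : exists2 x, x \in block I M & x \notin [set p].
    by apply/subsetPn; apply/negP=> /subset_leq_card; rewrite cards1 block3.
  rewrite !inE => xM xp; have ptM : I p (t M) by rewrite -sp st.
  have sx : s x != x.
    apply: contra tM => /eqP sx; apply/eqP.
    by apply: (line_unique xp _ ptM xM pM'); rewrite -sx st.
  have [K sxK xK] := join sx; have tK' := join_fixed x K sx xK sxK.
  have KM : K = M by apply: (line_unique xp) => //; apply: fixed_through.
  by rewrite -KM tK' eqxx in tM.
have tE M : (t M == M) = I p M.
  by apply/eqP/idP; [apply: fixed_through | apply: through_fixed].
(* A line off [p] is moved and meets its image in a fixed point [q]; joining [q] to [p] gives the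
   axis. *)
have [M pM'] := fano_line_off p; have tM : t M != M by rewrite tE.
have [q qtM qM] := meet tM.
have sq : s q = q.
  by apply: (point_unique tM); rewrite ?st // -{1}(tK M) st.
have pq : p != q by apply: contraNneq pM' => ->.
by have [A pA qA] := join pq; exists p, q, A.
Qed.

Lemma two_transitive_fano : two_transitive (f2 @* G) -> f1 @* G \isog [set: {'GL_3['F_2]}].
Proof.
move=> t2; have [C [D [_ _ neCD]]] : exists C D, [/\ C \in W, D \in W & C != D].
  by apply/card_gt1P; rewrite W7.
have cardQ := card_two_transitive neCD t2; rewrite W7 in cardQ.
(* The order has the factor [7 * 6], so it is even. *)
have [t /morphimP[g Gg _ ->] ord_t] : {t | t \in f2 @* G & #[t] = 2}.
  by apply: Cauchy => //; rewrite cardQ dvdn_mulr.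
have g2K : g * g \in 'ker f2.
  by rewrite !inE groupM //= morphM // -expg2 -ord_t expg_order.
have s1 : f1 g != 1.
  apply/eqP=> /(kerP f1 Gg); rewrite eqK => /mker tg1.
  by rewrite tg1 order1 in ord_t.
have [||p [q [A [pq pA qA sq tE]]]] := fano_elation (inv Gg) _ _ s1.
- by move=> x; rewrite -permM -morphM // (mker (_ : g * g \in 'ker f1)) ?eqK // perm1.
- by move=> x; rewrite -permM -morphM // (mker g2K) perm1.
have [p0 p0C p0D] := meet neCD.
(* For [M] through [p0], [e M] is a conjugate of [g] with centre [p0] and axis [M], obtained by
   moving the flag [(p, A)] to [(p0, M)]; [q'] is a fixed point on the axis other than the
   centre. *)
have [e eP] : exists e : W -> gT, forall M, I p0 M ->
    [/\ e M \in G, forall N, (f2 (e M) N == N) = I p0 N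
      & exists q', [/\ p0 != q', I q' M & f1 (e M) q' = q']].
  apply: (@fin_all_exists _ _ (fun M eM => I p0 M -> [/\ eM \in G,
     forall N, (f2 eM N == N) = I p0 N
      & exists q', [/\ p0 != q', I q' M & f1 eM q' = q']])) => M.
  have [p0M|] := boolP (I p0 M); last by exists 1.
  have [h Gh [hp hA]] := flag pA p0M.
  exists (g ^ h) => _; split; first exact: groupJ.
    move=> N; rewrite morphJ // -(permKV (f2 h) N) permJ (inj_eq perm_inj) tE.
    by rewrite -hp inv.
  exists (f1 h q); split; first by rewrite -hp (inj_eq perm_inj).
    by rewrite -hA inv.
  by rewrite morphJ // permJ sq.
pose S := 1 |: [set f2 (e M) | M in pencil I p0].
have S4 : #|S| = 4%N.
  rewrite cardsU1 card_in_imset ?pencil3.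
    suff -> : 1 \notin [set f2 (e M) | M in pencil I p0] by [].
    apply/imsetP=> -[M]; rewrite inE => /eP[_ fixM _] e1.
    by have [N] := fano_line_off p0; rewrite -fixM -e1 perm1 eqxx.
  move=> M M'; rewrite !inE => p0M p0M' eqe.
  have [[Ge fixM [q1 [pq1 q1M fq1]]] [Ge' _ [q2 [pq2 q2M fq2]]]] := (eP M p0M, eP M' p0M').
  apply/eqP; apply: contraT => neM.
  (* Elations that agree on lines agree on points. They then fix [q1] and [q2], hence the line
     joining these; a fixed line passes through [p0], so it would be both [M] and [M']. *)
  have eq1 : f1 (e M) = f1 (e M').
    by apply/(rcoset_kerP f1 Ge Ge'); rewrite eqK; apply/(rcoset_kerP f2 Ge Ge').
  have q12 : q1 != q2.
    by apply: contraNneq pq1 => eqq; rewrite (point_unique neM p0M q1M p0M') // eqq.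
  have [K q1K q2K] := join q12.
  have p0K : I p0 K.
    rewrite -fixM; apply/eqP; apply: (line_unique q12) => //.
      by rewrite -{1}fq1 inv.
    by rewrite -{1}fq2 -eq1 inv.
  have KM : K = M by apply: (line_unique pq1).
  have KM' : K = M' by apply: (line_unique pq2).
  by rewrite -KM KM' eqxx in neM.
(* All these elations have as centre the common point of [C] and [D], so they fix both lines. *)
have sSQ : S \subset 'C_('C_(f2 @* G)[C | 'P])[D | 'P].
  apply/subsetP=> u /setU1P[->|/imsetP[M]]; first exact: group1.
  rewrite inE => /eP[Ge fixM _] ->; rewrite 2!inE mem_morphim //=.
  by apply/andP; split; apply/astab1P/eqP; rewrite /= fixM.
have Q168 : 168 <= #|f2 @* G|.
  by rewrite cardQ -[168]/(7 * 7.-1 * 4)%N leq_mul2l -S4 subset_leq_card ?orbT.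
have [L [_ _ Lnc]] := fano_nonconcurrent neCD.
have [rho [rhoP rhoK]] := fano_rep (line_coordP U7 block3 pencil3 meet1 Lnc).
suff <- : rho @* G = [set: {'GL_3['F_2]}].
  by apply: isog_same_ker; rewrite ?subxx ?rhoK.
have isoG : rho @* G \isog f2 @* G by apply: isog_same_ker; rewrite ?subxx ?rhoK ?eqK.
by apply/eqP; rewrite eqEcard subsetT card_GL32 (card_isog isoG) Q168.
Qed.

End FanoGroup.

(** * Classification of the two-transitive designs *)

Section FlagTransitive.

Local Open Scope group_scope.

Variables (gT : finGroupType) (G : {group gT}).

(** With equal kernels the images on points and on blocks are isomorphic, and in degree four the
    order alone decides. *)
Lemma two_transitive_Alt_Sym (U : finType)
    (f1 : {morphism G >-> {perm U}}) (f2 : {morphism G >-> 'S_4}) :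
    'ker f1 = 'ker f2 ->
  two_transitive (f2 @* G) <->
  (f1 @* G \isog 'Alt_('I_4)) \/ (f1 @* G \isog 'Sym_('I_4)).
Proof.
move=> eqK; have isoG : f1 @* G \isog f2 @* G by apply: isog_same_ker; rewrite ?subxx ?eqK.
rewrite two_transitive_perm4; split=> [/perm4_dvdn12_Alt_Sym[] <-|iso4]; [by left | by right |].
rewrite -(card_isog isoG); case: iso4 => /card_isog ->.
  by rewrite card_Alt4.
by rewrite card_Sym4.
Qed.

Lemma isog_Alt_Sym_not_commute (rT : finGroupType) (H : {group rT}) :
    (H \isog 'Alt_('I_4)) \/ (H \isog 'Sym_('I_4)) ->
  exists s t, [/\ s \in H, t \in H, s ^+ 3 = 1, t ^+ 3 = 1 & s * t != t * s].
Proof.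
have [s [t [As At s3 t3 nst]]] := Alt4_order3_not_commute.
have transfer (K : {group 'S_4}) : s \in K -> t \in K -> H \isog K ->
  exists s t, [/\ s \in H, t \in H, s ^+ 3 = 1, t ^+ 3 = 1 & s * t != t * s].
- move=> Ks Kt; rewrite isog_sym => /isogP[f injf <-]; exists (f s), (f t).
  rewrite !mem_morphim // -!morphX // s3 t3 morph1 -!morphM //; split=> //.
  by apply: contra nst => /eqP/(injmP injf)-> //; rewrite groupM.
by case; apply: transfer; rewrite // inE.
Qed.

Variables (v b r : nat) (f1 : {morphism G >-> 'S_v}) (f2 : {morphism G >-> 'S_b}).
Variables (I : 'I_v -> 'I_b -> bool).
Hypothesis inv : {in G, forall g x C, I (f1 g x) (f2 g C) = I x C}.
Hypothesis flag : forall x C x' C', I x C -> I x' C' ->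
  exists2 g, g \in G & f1 g x = x' /\ f2 g C = C'.
Hypothesis block3 : forall C, #|block I C| = 3%N.
Hypothesis pencilr : forall x, #|pencil I x| = r.

(** The structure and its dual satisfy the same numerical conditions, so points as well as blocks
    are determined by their incidences. *)
Lemma eq_kernels_443 : (v, b, r) = (4, 4, 3)%N -> 'ker f1 = 'ker f2.
Proof.
case=> v4 b4 r3; have pencil3 x : #|pencil I x| = 3%N by rewrite pencilr.
apply: (eq_kernels inv); first by apply: block_injective_443; rewrite ?card_ord.
by apply: (@block_injective_443 _ _ (fun C x => I x C)); rewrite ?card_ord.
Qed.

Lemma eq_kernels_meet1 : r = 2 ->
  (forall C D, C != D -> #|block I C :&: block I D| = 1%N) -> 'ker f1 = 'ker f2.
Proof.
move=> r2 meet1; apply: (eq_kernels inv) => [C D eqCD|x y eqxy].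
  by apply/eqP; apply: contraT => /meet1; rewrite eqCD setIid block3.
have le1 C D : C != D -> #|block I C :&: block I D| <= 1 by move/meet1->.
apply/eqP; apply: contraT => /(card_pencil_meet_le1 le1).
by rewrite eqxy setIid pencilr r2.
Qed.

(** In the backward direction the sizes of the meets are not given; for six and seven points they
    are first recovered from flag-transitivity, for six also from noncommuting elements of cube
    one. *)
Theorem flag_transitive_two_transitive : 1 < b -> v != 3%N ->
  two_transitive (f2 @* G) <->
  [\/ (v, b, r) = (4, 4, 3)%N /\
        ((f1 @* G \isog 'Alt_('I_4)) \/ (f1 @* G \isog 'Sym_('I_4))),
      (v, b, r) = (6, 4, 2)%N /\
        ((f1 @* G \isog 'Alt_('I_4)) \/ (f1 @* G \isog 'Sym_('I_4))),
      (v, b, r) = (7, 7, 3)%N /\ (f1 @* G \isog PSL 3 'F_2)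
    | [/\ v = (3 * b)%N, 6 <= v, r = 1%N & two_transitive (f2 @* G)]].
Proof.
move=> b2 v3; split=> [t2|].
  have := two_transitive_params inv block3 pencilr t2; rewrite !card_ord => /(_ b2 v3).
  case=> [[v4 b4 r3]|[v6 b4 r2 meet1]|[v7 b7 r3 meet1]|[r1 v3b]].
  - have eqK := eq_kernels_443 (congr2 pair (congr2 pair v4 b4) r3).
    constructor 1; split; first by rewrite v4 b4 r3.
    by clear inv flag block3 pencilr; subst b; apply/(two_transitive_Alt_Sym eqK).
  - have eqK := eq_kernels_meet1 r2 meet1.
    constructor 2; split; first by rewrite v6 b4 r2.
    by clear inv flag block3 pencilr meet1; subst b; apply/(two_transitive_Alt_Sym eqK).
  - constructor 3; split; first by rewrite v7 b7 r3.
    have pencil3 x : #|pencil I x| = 3%N by rewrite pencilr.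
    apply: isog_trans (_ : [set: {'GL_3['F_2]}] \isog PSL 3 'F_2).
      by apply: (two_transitive_fano inv flag); rewrite ?card_ord.
    by rewrite isog_sym PSL32_isog.
  by constructor 4; split=> //; lia.
case=> [[params iso4]|[params iso4]|[params iso7]|[_ _ _ //]].
- have eqK := eq_kernels_443 params; case: params => _ b4 _.
  by clear inv flag block3 pencilr; subst b; apply/(two_transitive_Alt_Sym eqK).
- case: params => v6 b4 r2.
  have meet1 : forall C D, C != D -> #|block I C :&: block I D| = 1%N.
    apply: (card_meet_642 inv flag block3 pencilr); rewrite ?card_ord //.
    exact: isog_Alt_Sym_not_commute.
  have eqK := eq_kernels_meet1 r2 meet1.
  by clear inv flag block3 pencilr meet1; subst b; apply/(two_transitive_Alt_Sym eqK).
case: params => v7 b7 r3; have pencil3 x : #|pencil I x| = 3%N by rewrite pencilr.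
apply: (fano_two_transitive inv); rewrite ?card_ord //.
  by apply: (card_meet_773 inv flag block3 pencilr); rewrite ?card_ord.
by rewrite (card_isog iso7) (card_isog PSL32_isog) card_GL32.
Qed.

End FlagTransitive.

(** * Arcs, transitivity and induced permutation groups *)

Section Arcs.

Variables (T : finType) (S : sgraph T).

Lemma adj_vertsR x y : adj S x y -> y \in verts S.
Proof. by rewrite adj_sym => /adj_verts. Qed.

Lemma mem_arcs1 x y : ([tuple x; y] \in s_arcs S 1) = adj S x y.
Proof.
rewrite inE /= andbT; apply/andP/idP=> [[_ /forallP/(_ ord0)/forallP/(_ ord_max)]|xy].
  by case/andP.
rewrite (adj_verts xy) (adj_vertsR xy); split=> //.
by apply/forallP=> -[[|[|i]] //= ?]; apply/forallP=> -[[|[|j]] //= ?]; rewrite ?andbT.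
Qed.

Lemma mem_arcs2 x y z :
  ([tuple x; y; z] \in s_arcs S 2) = [&& adj S x y, adj S y z & x != z].
Proof.
rewrite inE /= andbT; apply/andP/idP=> [[_ /forallP arc]|/and3P[xy yz xz]].
  have /forallP/(_ (inord 1)) := arc ord0; rewrite inordK // => /andP[/= + _].
  have /forallP/(_ ord_max) := arc (inord 1); rewrite inordK // => /andP[/= + _].
  have /forallP/(_ ord_max) := arc ord0 => /andP[_ /= ->].
  by rewrite !(tnth_nth x) /= !inordK //= => -> ->.
rewrite (adj_verts xy) (adj_vertsR xy) (adj_vertsR yz); split=> //.
by apply/forallP=> -[[|[|[|i]]] //= ?]; apply/forallP=> -[[|[|[|j]]] //= ?];
   rewrite ?andbT.
Qed.

End Arcs.

Lemma atransI (aT : finGroupType) (rT : finType) (to : {action aT &-> rT})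
    (A : {group aT}) (S : {set rT}) (x : rT) :
    x \in S -> (forall g, g \in A -> to x g \in S) ->
    (forall y, y \in S -> exists2 g, g \in A & to x g = y) ->
  [transitive A, on S | to].
Proof.
move=> Sx actS trS; apply/imsetP; exists x => //; apply/setP=> y; apply/idP/imsetP.
  by case/trS=> g Ag <-; exists g.
by case=> g Ag ->; apply: actS.
Qed.

(** In both representations the kernel consists of the elements of the stabiliser fixing [B]
    pointwise. *)
Lemma induced_perm_group_isog (gT : finGroupType) (T : finType)
    (to : {action gT &-> T}) (X : {group gT}) (B : {set T}) (n : nat)
    (e : 'I_n -> T) (f : {morphism ('N_X(B | to))%g >-> 'S_n}) :
    injective e -> (forall i, e i \in B) -> (forall x, x \in B -> exists i, e i = x) ->
    {in 'N_X(B | to), forall g i, e (f g i) = to (e i) g}%g ->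
  exists2 H : {group {perm T}}, H :=: induced_perm_group to X B
    & (H \isog f @* 'N_X(B | to))%g.
Proof.
move=> e_inj eB e_surj fP; set G := ('N_X(B | to))%g in f fP *.
have stabP g : g \in G -> actperm to g \in 'N(B | 'P)%g.
  case/setIP=> _ Ng; rewrite !inE; apply/subsetP=> y By.
  by rewrite inE /= apermE permE /= (astabs_act _ Ng).
pose h g := restr_perm B (actperm to g).
have hM : {in G &, {morph h : g g' / (g * g')%g}}.
  move=> g g' Gg Gg'; rewrite /h actpermM ?inE // morphM ?stabP //.
pose hm := Morphism hM; exists (hm @* G)%G.
  rewrite /= /induced_perm_group morphimEdom morphimEsub; last first.
    by apply/subsetP=> _ /morphimP[g _ Gg ->]; apply: stabP.
  by rewrite morphimEsub -?imset_comp //; apply/subsetP=> ? _; rewrite inE.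
apply: isog_same_ker => //; congr (_ :&: _).
have hE g y : g \in G -> y \in B -> h g y = to y g.
  by move=> Gg By; rewrite /h restr_permE ?stabP // permE.
apply/setP=> g; apply/idP/idP=> Kg.
  have Gg := dom_ker Kg; apply/(kerP f Gg)/permP=> i; apply: e_inj.
  by rewrite fP // perm1 -hE // -[h g]/(hm g) (mker Kg) perm1.
have Gg := dom_ker Kg; apply/(kerP hm Gg)/permP=> y; rewrite perm1 /=.
have [By|nBy] := boolP (y \in B); last by rewrite /h (out_perm (restr_perm_on _ _)).
by rewrite hE //; have [i <-] := e_surj y By; rewrite -fP // (mker Kg) perm1.
Qed.

(** * Quotients of symmetric graphs and the design on a block *)

Section SymmetricQuotient.

Variables (T : finType) (gT : finGroupType) (to : {action gT &-> T}) (X : {group gT}).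
Variables (Gamma : sgraph T) (P : {set {set T}}) (B C : {set T}).
Let GammaP := quotient_graph Gamma P.
Hypothesis symX : symmetric_graph Gamma to X.
Hypothesis invP : invariant_partition Gamma to X P.
Hypothesis adjBC : quot_adj Gamma P B C.

Lemma adj_act g x y : g \in X -> adj Gamma (to x g) (to y g) = adj Gamma x y.
Proof.
move=> Xg; have [[actX monoX] _ _] := symX.
have mono h u w : h \in X -> adj Gamma u w -> adj Gamma (to u h) (to w h).
  by move=> Xh uw; rewrite monoX ?(adj_verts uw) ?(adj_vertsR uw).
apply/idP/idP=> [xy|]; last exact: mono.
by rewrite -(actK to g x) -(actK to g y) mono ?groupV.
Qed.

Lemma arc_transitive x y x' y' : adj Gamma x y -> adj Gamma x' y' ->
  exists2 g, g \in X & to x g = x' /\ to y g = y'.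
Proof.
move=> xy xy'; have [_ _ tr] := symX.
have arc1 : [tuple x; y] \in s_arcs Gamma 1 by rewrite mem_arcs1.
have arc2 : [tuple x'; y'] \in s_arcs Gamma 1 by rewrite mem_arcs1.
by have [g Xg [-> ->]] := atransP2 tr arc1 arc2; exists g.
Qed.

Lemma part_verts D x : D \in P -> x \in D -> x \in verts Gamma.
Proof.
move=> PD Dx; have /andP[/and3P[/eqP <- _ _] _] := invP.
by apply/bigcupP; exists D.
Qed.

Lemma part_eq D E x : D \in P -> E \in P -> x \in D -> x \in E -> D = E.
Proof.
move=> PD PE Dx Ex; have /andP[/and3P[_ tI _] _] := invP.
by rewrite -(def_pblock tI PD Dx) (def_pblock tI PE Ex).
Qed.

Lemma part_act D g : g \in X -> ((to^* D g)%act \in P) = (D \in P).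
Proof. by move=> Xg; have /andP[_ actP] := invP; rewrite (actsP actP). Qed.

Lemma part_cover x : x \in verts Gamma -> exists2 D, D \in P & x \in D.
Proof.
have /andP[/and3P[/eqP <- _ _] _] := invP.
by case/bigcupP=> D; exists D.
Qed.

Lemma mem_act D g x : (to x g \in (to^* D g)%act) = (x \in D).
Proof.
by apply/imsetP/idP=> [[y Dy /act_inj->] // | Dx]; exists x.
Qed.

Lemma set_act_eq D E g x : g \in X -> D \in P -> E \in P ->
  x \in D -> to x g \in E -> (to^* D g)%act = E.
Proof.
by move=> Xg PD PE Dx Exg; apply: (part_eq (x := to x g)); rewrite ?part_act ?mem_act.
Qed.

(** No block contains an edge: arc-transitivity would carry it to an edge between [B] and [C] and
    force [B = C]. *)
Lemma quot_adj_of D E x y : D \in P -> E \in P -> x \in D -> y \in E ->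
  adj Gamma x y -> quot_adj Gamma P D E.
Proof.
move=> PD PE Dx Ey xy; rewrite /quot_adj PD PE /=; apply/andP; split; last first.
  by apply/exists_inP; exists x => //; apply/exists_inP; exists y.
have /and4P[PB PC /negP neBC /exists_inP[u Bu /exists_inP[w Cw uw]]] := adjBC.
apply/negP=> /eqP eqDE; case: neBC; have [g Xg [xu yw]] := arc_transitive xy uw.
rewrite -(@set_act_eq D B g x) ?xu // eqDE.
by rewrite (@set_act_eq E C g y) ?yw.
Qed.

Lemma quot_adjP D E : reflect
  [/\ D \in P, E \in P & exists x y, [/\ x \in D, y \in E & adj Gamma x y]]
  (quot_adj Gamma P D E).
Proof.
apply: (iffP idP) => [|[PD PE [x [y [Dx Ey xy]]]]]; last exact: quot_adj_of xy.
case/and4P=> PD PE _ /exists_inP[x Dx /exists_inP[y Ey xy]].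
by split=> //; exists x, y.
Qed.

Lemma quot_adj_act D E g : g \in X ->
  quot_adj Gamma P (to^* D g)%act (to^* E g)%act = quot_adj Gamma P D E.
Proof.
move=> Xg.
have mono h F F' : h \in X -> quot_adj Gamma P F F' ->
    quot_adj Gamma P (to^* F h)%act (to^* F' h)%act.
  move=> Xh /quot_adjP[PF PF' [x [y [Fx F'y xy]]]].
  by apply: (@quot_adj_of _ _ (to x h) (to y h)); rewrite ?part_act ?mem_act ?adj_act.
apply/idP/idP=> [DE|]; last exact: mono.
by rewrite -(actK to^* g D) -(actK to^* g E) mono ?groupV.
Qed.

Lemma quot_arc_transitive D E D' E' :
    quot_adj Gamma P D E -> quot_adj Gamma P D' E' ->
  exists2 g, g \in X & (to^* D g)%act = D' /\ (to^* E g)%act = E'.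
Proof.
move=> /quot_adjP[PD PE [x [y [Dx Ey xy]]]] /quot_adjP[PD' PE' [x' [y' [Dx' Ey' xy']]]].
have [g Xg [gx gy]] := arc_transitive xy xy'; exists g => //.
by split; [apply: (set_act_eq (x := x)) | apply: (set_act_eq (x := y))]; rewrite ?gx ?gy.
Qed.

Lemma quot_symmetric : symmetric_graph GammaP to^*%act X.
Proof.
have /andP[_ actP] := invP.
split; first by split=> // g Xg D E _ _ /=; rewrite quot_adj_act.
  have PB := adj_verts (s := GammaP) adjBC.
  apply: (atransI (x := B)) => // [g Xg|D PD]; first by rewrite /= part_act.
  have [x0 [y0 [Bx0 Cy0 xy0]]] : exists x y, [/\ x \in B, y \in C & adj Gamma x y].
    by case/quot_adjP: adjBC.
  have /set0Pn[x Dx] : D != set0.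
    by have /andP[/and3P[_ _ nP0] _] := invP; apply: contraNneq nP0 => <-.
  have [_ trX _] := symX.
  have [g Xg gx] := atransP2 trX (adj_verts xy0) (part_verts PD Dx).
  by exists g => //; apply: (set_act_eq (x := x0)); rewrite -?gx.
apply: (atransI (x := [tuple B; C])) => [|g Xg|t]; first by rewrite mem_arcs1.
  have -> : (to^* * 2)%act [tuple B; C] g = [tuple (to^* B g)%act; (to^* C g)%act].
    exact: val_inj.
  by rewrite mem_arcs1 /= quot_adj_act.
case/tupleP: t => D t; case/tupleP: t => E t; rewrite (tuple0 t) mem_arcs1 => DE.
have [g Xg [gB gC]] := quot_arc_transitive adjBC DE.
by exists g => //; apply: val_inj; rewrite /= gB gC.
Qed.

Let G := ('N_X(B | to))%G.
Let N := nbhd GammaP B.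

Lemma mem_nbhd D : (D \in N) = quot_adj Gamma P B D.
Proof. by rewrite inE; apply: andb_idl => /and4P[]. Qed.

Lemma stab_block g : (g \in G) = (g \in X) && ((to^* B g)%act == B).
Proof.
rewrite inE; congr (_ && _); apply/idP/eqP=> [Ng|gB]; first exact: (astabs_setact Ng).
by rewrite !inE; apply/subsetP=> y By; rewrite inE -[in X in _ \in X]gB mem_act.
Qed.

Lemma stab_acts_block : [acts G, on B | to].
Proof. exact: subsetIr. Qed.

Lemma stab_acts_nbhd : [acts G, on N | to^*].
Proof.
apply/actsP=> g; rewrite stab_block => /andP[Xg /eqP gB] D.
by rewrite !mem_nbhd -{1}gB quot_adj_act.
Qed.

(** The 2-arcs with middle vertex [B] are the ordered pairs of distinct neighbours of [B]. *)
Lemma two_arc_transitiveP : 1 < #|N| ->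
  two_arc_transitive GammaP to^*%act X <-> [transitive^2 G, on N | to^*].
Proof.
move=> N2; split=> [[_ tr]|/(ntransitive2P N2 stab_acts_nbhd) tr].
  apply/ntransitive2P; rewrite ?stab_acts_nbhd // => D E D' ND NE ND' E' NE' neDE neDE'.
  have arcB F F' : F \in N -> F' \in N -> F != F' -> [tuple F; B; F'] \in s_arcs GammaP 2.
    rewrite !mem_nbhd => NF NF' neF; rewrite mem_arcs2 neF andbT.
    by rewrite adj_sym; apply/andP.
  have [g Xg [gD gB gE]] := atransP2 tr (arcB D E ND NE neDE) (arcB D' E' ND' NE' neDE').
  exists g; first by rewrite stab_block Xg /=; apply/eqP/esym.
  by split; apply: esym.
split; first exact: quot_symmetric.
have [D [E [ND NE neDE]]] := card_gt1P N2.
have [BD BE] : quot_adj Gamma P B D /\ quot_adj Gamma P B E by rewrite -!mem_nbhd.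
apply: (atransI (x := [tuple D; B; E])) => [|g Xg|t].
- by rewrite mem_arcs2 neDE adj_sym /= BD BE.
- have -> : (to^* * 3)%act [tuple D; B; E] g =
            [tuple (to^* D g)%act; (to^* B g)%act; (to^* E g)%act] by exact: val_inj.
  by rewrite mem_arcs2 adj_sym /= !quot_adj_act // BD BE (inj_eq (act_inj to^* g)).
case/tupleP: t => F t; case/tupleP: t => H t; case/tupleP: t => F' t.
rewrite (tuple0 t) mem_arcs2 /= => /and3P[FH HF' neF].
(* Pull the 2-arc back so that it starts with [D], [B]; two-transitivity then moves [E] to its last
   vertex while fixing [D]. *)
have [g Xg [gD gB]] := quot_arc_transitive (etrans (quot_adj_sym _ _ _ _) BD) FH.
have NF' : (to^* F' g^-1%g)%act \in N.
  by rewrite mem_nbhd -(quot_adj_act _ _ Xg) actKV gB.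
have neF' : D != (to^* F' g^-1%g)%act.
  by apply: contra neF => /eqP eqD; rewrite -gD eqD actKV.
have [h Gh [hD hE]] := tr D E D ND NE ND _ NF' neDE neF'.
move: Gh; rewrite stab_block => /andP[Xh /eqP hB].
exists (h * g)%g; first by rewrite groupM.
by apply: val_inj; rewrite /= !actM hD hB hE gD gB actKV.
Qed.

Definition incident (x : T) (D : {set T}) := x \in set_nbhd Gamma D.

Lemma mem_set_nbhd x D : (x \in set_nbhd Gamma D) = incident x D.
Proof. by []. Qed.

Lemma incidentP x (D : {set T}) : reflect (exists2 y, y \in D & adj Gamma x y) (incident x D).
Proof.
apply: (iffP bigcupP) => [[y Dy]|[y Dy xy]].
  by rewrite inE adj_sym => /andP[_ xy]; exists y.
by exists y => //; rewrite inE adj_sym xy (adj_verts xy).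
Qed.

Lemma incident_act x D g : g \in X -> incident (to x g) (to^* D g)%act = incident x D.
Proof.
move=> Xg; apply/incidentP/incidentP=> [[_ /imsetP[y Dy ->]]|[y Dy xy]].
  by rewrite adj_act // => xy; exists y.
by exists (to y g); rewrite ?mem_act ?adj_act.
Qed.

Lemma incident_nbhd x D : x \in B -> D \in P -> incident x D -> D \in N.
Proof.
move=> Bx PD /incidentP[y Dy xy]; rewrite mem_nbhd.
by apply: quot_adj_of xy => //; case/and4P: adjBC.
Qed.

(** A flag [(x, D)] comes from an arc that starts at [x] and ends in [D]. An element moving one such
    arc to another sends a vertex of [B] into [B], so it stabilises [B]. *)
Lemma incident_flag x D x' D' : x \in B -> x' \in B -> D \in N -> D' \in N ->
    incident x D -> incident x' D' ->
  exists2 g, g \in G & to x g = x' /\ (to^* D g)%act = D'.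
Proof.
move=> Bx Bx'; rewrite !mem_nbhd => /and4P[PB PD _ _] /and4P[_ PD' _ _].
case/incidentP=> y Dy xy /incidentP[y' Dy' xy'].
have [g Xg [gx gy]] := arc_transitive xy xy'; exists g.
  by rewrite stab_block Xg; apply/eqP/(set_act_eq (x := x)); rewrite ?gx.
by split=> //; apply: (set_act_eq (x := y)); rewrite ?gy.
Qed.

Lemma block_incident D : D \in N -> exists2 x, x \in B & incident x D.
Proof.
rewrite mem_nbhd => /quot_adjP[_ _ [x [y [Bx Dy xy]]]].
by exists x => //; apply/incidentP; exists y.
Qed.

(** By vertex-transitivity [x] has a neighbour, and the block containing it is incident with [x]. *)
Lemma point_incident x : x \in B -> exists2 D, D \in N & incident x D.
Proof.
move=> Bx; have [PB PC [x0 [y0 [Bx0 Cy0 xy0]]]] := quot_adjP _ _ adjBC.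
have [_ trX _] := symX; have [g Xg gx] := atransP2 trX (adj_verts xy0) (part_verts PB Bx).
have xy : adj Gamma x (to y0 g) by rewrite gx adj_act.
have [D PD Dy] := part_cover (adj_vertsR xy).
have xD : incident x D by apply/incidentP; exists (to y0 g).
by exists D => //; apply: incident_nbhd xD.
Qed.

Lemma card_incident_block D D' : D \in N -> D' \in N ->
  param_k Gamma B D = param_k Gamma B D'.
Proof.
move=> ND ND'; have [x Bx xD] := block_incident ND; have [x' Bx' xD'] := block_incident ND'.
have [g Gg [_ <-]] := incident_flag Bx Bx' ND ND' xD xD'.
have [Xg Ng] := setIP Gg; rewrite /param_k -(card_imset _ (act_inj to g)); apply: eq_card => y.
rewrite -[y](actKV to g) !inE (mem_imset _ _ (act_inj to g)) inE.
by rewrite !mem_set_nbhd incident_act // (astabs_act _ Ng).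
Qed.

Lemma card_block_nbhd x x' : x \in B -> x' \in B ->
  param_r Gamma P x = param_r Gamma P x'.
Proof.
move=> Bx Bx'; have [D ND xD] := point_incident Bx; have [D' ND' xD'] := point_incident Bx'.
have [g Gg [<- _]] := incident_flag Bx Bx' ND ND' xD xD'.
have [Xg Ng] := setIP Gg; rewrite /param_r -(card_imset _ (act_inj to^* g)).
apply: eq_card => E; rewrite -[E](actKV to^* g) (mem_imset _ _ (act_inj to^* g)) !inE.
by rewrite (part_act _ Xg) !mem_set_nbhd incident_act.
Qed.

End SymmetricQuotient.

(** * Passage from the graph to the numbered design and back *)

Theorem theorem1p1 (T : finType) (gT : finGroupType)
    (to : {action gT &-> T}) (X : {group gT})
    (Gamma : sgraph T) (P : {set {set T}}) (B C : {set T}) (x : T) :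
  let GammaP := quotient_graph Gamma P in
  let v := param_v B in
  let k := param_k Gamma B C in
  let r := param_r Gamma P x in
  let b := param_b Gamma P B in
  symmetric_graph Gamma to X ->
  invariant_partition Gamma to X P ->
  nontrivial_partition Gamma P ->
  B \in P -> C \in nbhd GammaP B -> x \in B ->
  k = 3 -> 2 <= b ->
  [faithful X, on verts Gamma | to] ->
  ~ multicover Gamma B C ->
  two_arc_transitive GammaP (to^*)%act X <->
  [\/ (v, b, r) = (4, 4, 3) /\
        ((induced_perm_group to X B \isog 'Alt_('I_4))%g \/
         (induced_perm_group to X B \isog 'Sym_('I_4))%g),
      (v, b, r) = (6, 4, 2) /\
        ((induced_perm_group to X B \isog 'Alt_('I_4))%g \/
         (induced_perm_group to X B \isog 'Sym_('I_4))%g),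
      (v, b, r) = (7, 7, 3) /\
        (induced_perm_group to X B \isog PSL 3 'F_2)%g
    | [/\ v = 3 * b, 6 <= v, r = 1
        & [transitive^2 'N_X(B | to), on nbhd GammaP B | to^*]]].
Proof.
move=> GammaP v k r b symX invP _ PB NC Bx k3 b2 _ ncover.
have adjBC : quot_adj Gamma P B C by rewrite -(mem_nbhd Gamma P).
rewrite (two_arc_transitiveP symX invP adjBC b2).
have [e1 [f1 [e1_inj e1B e1_surj f1P]]] := acts_perm_morphism (stab_acts_block to X B).
have [e2 [f2 [e2_inj e2N e2_surj f2P]]] :=
  acts_perm_morphism (stab_acts_nbhd symX invP adjBC).
have [H <- isoH] := induced_perm_group_isog e1_inj e1B e1_surj f1P.
(* This is the design on [B], its points and blocks numbered by [e1] and [e2]. *)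
pose I i j := incident Gamma (e1 i) (e2 j).
have inv : {in 'N_X(B | to)%G, forall g i j, I (f1 g i) (f2 g j) = I i j}.
  move=> g Gg i j; rewrite /I f1P // f2P //.
  by apply: (incident_act symX); case/setIP: Gg.
have flag i j i' j' : I i j -> I i' j' ->
    exists2 g, g \in 'N_X(B | to)%G & f1 g i = i' /\ f2 g j = j'.
  move=> ij ij'; have [g Gg [gi gj]] :=
    incident_flag symX invP (e1B i) (e1B i') (e2N j) (e2N j') ij ij'.
  by exists g => //; split; [apply: e1_inj; rewrite f1P | apply: e2_inj; rewrite f2P].
have block3 j : #|block I j| = 3.
  rewrite -[RHS]k3 /k (card_incident_block symX invP adjBC NC (e2N j)).
  rewrite /param_k -(card_imset _ e1_inj); apply: eq_card => y; rewrite inE.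
  apply/imsetP/andP=> [[i + ->]|[yj /e1_surj[i defy]]]; first by rewrite inE.
  by exists i; rewrite // inE /I defy.
have pencilr i : #|pencil I i| = r.
  rewrite /r (card_block_nbhd symX invP adjBC Bx (e1B i)).
  rewrite /param_r -(card_imset _ e2_inj); apply: eq_card => D; rewrite inE.
  apply/imsetP/andP=> [[j + ->]|[PD iD]].
    by rewrite inE => ij; have := e2N j; rewrite inE => /andP[].
  have [j defD] := e2_surj D (incident_nbhd symX invP adjBC (e1B i) PD iD).
  by exists j; rewrite // inE /I defD.
(* Since [k = 3], having [v = 3] is exactly the multicover case. *)
have v3 : v != 3 by apply/eqP=> v3; apply: ncover; rewrite /multicover -/v v3.
have t2P : [transitive^2 'N_X(B | to)%G, on nbhd GammaP B | to^*] <->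
           two_transitive (f2 @* 'N_X(B | to)%G)%g.
  have tr := ntransitive2P b2 (stab_acts_nbhd symX invP adjBC).
  split=> [/tr {}tr i j i' j' neij neij'|t2].
    have [||g Gg [gi gj]] := tr _ _ _ (e2N i) (e2N j) (e2N i') _ (e2N j').
    - by rewrite (inj_eq e2_inj).
    - by rewrite (inj_eq e2_inj).
    exists (f2 g); first exact: mem_morphim.
    by split; apply: e2_inj; rewrite f2P.
  apply/tr=> _ _ _ /e2_surj[i <-] /e2_surj[j <-] /e2_surj[i' <-] _ /e2_surj[j' <-].
  rewrite !(inj_eq e2_inj) => neij neij'.
  have [_ /morphimP[g Gg _ ->] [<- <-]] := t2 _ _ _ _ neij neij'.
  by exists g; rewrite // !f2P.
have isoE (rT : finGroupType) (K : {group rT}) :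
    (H \isog K)%g = (f1 @* 'N_X(B | to)%G \isog K)%g.
  apply/idP/idP; last exact: isog_trans.
  by apply: isog_trans; rewrite isog_sym.
have core := flag_transitive_two_transitive inv flag block3 pencilr b2 v3.
apply: (iff_trans t2P); apply: (iff_trans core); rewrite /PSL !isoE.
by split=> -[h|h|h|[vb v6 r1 /t2P t2]];
  [constructor 1 | constructor 2 | constructor 3 | constructor 4
  |constructor 1 | constructor 2 | constructor 3 | constructor 4].
Qed.
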